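(* The decision problem ''given a graph $G$, is $\chi_{2K_2}(G) \le 3$?'' can be solved in polynomial time.
   Context: All graphs are finite and simple. For a fixed bipartite graph $H$, a proper vertex coloring of a graph $G$ is called an $H$-avoiding coloring if for any two color classes, the subgraph of $G$ induced by their union contains no induced subgraph isomorphic to $H$. $\chi_H(G)$ denotes the minimum number of colors in an $H$-avoiding coloring of $G$. $2K_2$ is the disjoint union of two edges. *)

(* Defs.v *)
From mathcomp Require Import all_boot.
Set Implicit Arguments. Unset Strict Implicit. Unset Printing Implicit Defensive.

Record sgraph (n : nat) := SGraph {
  adj : rel 'I_n;
  adj_sym : symmetric adj;
  adj_irr : irreflexive adj }.

Definition has_induced_2K2 n (G : sgraph n) (S : {set 'I_n}) : bool :=
  [exists x1, exists y1, exists x2, exists y2,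
    [&& [&& x1 \in S, y1 \in S, x2 \in S & y2 \in S],
        uniq [:: x1; y1; x2; y2],
        adj G x1 y1, adj G x2 y2,
        ~~ adj G x1 x2, ~~ adj G x1 y2, ~~ adj G y1 x2 & ~~ adj G y1 y2]].

Definition avoid2K2_coloring n (G : sgraph n) k (c : {ffun 'I_n -> 'I_k}) : bool :=
  [forall x, forall y, adj G x y ==> (c x != c y)] &&
  [forall a : 'I_k, forall b : 'I_k,
     (a != b) ==> ~~ has_induced_2K2 G [set v | (c v == a) || (c v == b)]].

Definition avoid2K2_colorable n (G : sgraph n) k : bool :=
  [exists c : {ffun 'I_n -> 'I_k}, avoid2K2_coloring G c].

Lemma avoid2K2_colorable_ex n (G : sgraph n) : exists k, avoid2K2_colorable G k.
Proof.
exists n; apply/existsP; exists [ffun v => v]; apply/andP; split.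
  apply/forallP=> x; apply/forallP=> y; apply/implyP=> exy; rewrite !ffunE.
  by apply/eqP=> Exy; move: exy; rewrite Exy (adj_irr G).
apply/forallP=> a; apply/forallP=> b; apply/implyP=> _.
apply/negP=> /existsP[x1 /existsP[y1 /existsP[x2 /existsP[y2]]]].
case/and3P=> /and4P[]; rewrite !inE !ffunE => h1 h2 h3 _ /and3P[] + + _ _.
rewrite /= !inE !negb_or => /and3P[n12 n13 _] /andP[n23 _].
by move: h1 h2 h3 n12 n13 n23 => /orP[]/eqP-> /orP[]/eqP-> /orP[]/eqP->;
  rewrite ?eqxx // eq_sym.
Qed.

Definition chi_2K2 n (G : sgraph n) : nat := ex_minn (avoid2K2_colorable_ex G).

(** * Deterministic single-tape Turing machines (two-way infinite tape),
      tape alphabet {blank, 0, 1}. *)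
Definition tsym := option bool.
Inductive move := MoveL | MoveR | Stay.

Record TM := {
  tm_state : finType;
  tm_start : tm_state;
  tm_accept : tm_state;
  tm_reject : tm_state;
  tm_delta : tm_state -> tsym -> tm_state * tsym * move }.

Record config (M : TM) := Cfg {
  cstate : tm_state M;
  cleft : seq tsym;    (* cells left of the head, nearest first *)
  chead : tsym;
  cright : seq tsym }. (* cells right of the head, nearest first *)

Definition halted (M : TM) (C : config M) : bool :=
  (cstate C == tm_accept M) || (cstate C == tm_reject M).

Definition step (M : TM) (C : config M) : config M :=
  if halted C then C else
  let: (q', s', m) := tm_delta (cstate C) (chead C) in
  match m with
  | MoveL => Cfg q' (behead (cleft C)) (head None (cleft C)) (s' :: cright C)
  | MoveR => Cfg q' (s' :: cleft C) (head None (cright C)) (behead (cright C))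
  | Stay => Cfg q' (cleft C) s' (cright C)
  end.

Definition init (M : TM) (w : seq bool) : config M :=
  match w with
  | [::] => Cfg (tm_start M) [::] None [::]
  | b :: w' => Cfg (tm_start M) [::] (Some b) (map Some w')
  end.

Definition run (M : TM) (w : seq bool) (t : nat) : config M := iter t (@step M) (init M w).

Definition encode n (G : sgraph n) : seq bool :=
  [seq adj G i j | i <- enum 'I_n, j <- enum 'I_n].

(* Main.v *)
Require Import Defs.
From mathcomp Require Import all_boot zify.
Set Implicit Arguments. Unset Strict Implicit. Unset Printing Implicit Defensive.

(** In a 2K2-avoiding 3-colouring any two colour classes p, q span a bipartite
    chain graph, so some vertex g(p, q) of colour p is adjacent to every vertex
    of colour q that has a neighbour of colour p.  After guessing these vertices
    (polynomially many possibilities), a vertex adjacent to g(p, _) cannot have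
    colour p, which leaves at most two colours for each non-isolated vertex, and
    an edge may be coloured (p, q) only if its ends are adjacent to g(q, p) and
    g(p, q).  These restrictions make one end of each edge decide which colour
    the edge avoids, so "no two edges of an induced 2K2 avoid the same colour"
    becomes a constraint on pairs of vertices.  The resulting binary constraint
    problem with lists of size two is solved by eliminating the vertices one
    after the other.

    The Turing machine keeps n ^ 2 blocks of bits on its tape, one for each entry
    of the adjacency matrix, and works by left-to-right sweeps over the blocks.
    Loops over all vertices and random access to n x n bit matrices are
    implemented by a constant number of sweeps per step. *)

Definition tape_at (M : TM) (q : tm_state M) (l r : seq tsym) : config M :=
  Cfg q l (head None r) (behead r).

Definition tape_left (M : TM) (q : tm_state M) (l r : seq tsym) : config M :=
  Cfg q (behead l) (head None l) r.

Definition reaches (M : TM) (T : nat) (C C' : config M) :=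
  exists2 t, t <= T & iter t (@step M) C = C'.

Section Reaches.
Variable M : TM.
Implicit Types (C : config M) (q : tm_state M) (l r : seq tsym).

Lemma reaches_refl T C : reaches T C C.
Proof. by exists 0. Qed.

Lemma reaches_trans T1 T2 C1 C2 C3 :
  reaches T1 C1 C2 -> reaches T2 C2 C3 -> reaches (T1 + T2) C1 C3.
Proof.
move=> [t1 le1 <-] [t2 le2 <-]; exists (t2 + t1); first lia.
by rewrite iterD.
Qed.

Lemma reaches_leq T1 T2 C1 C2 : T1 <= T2 -> reaches T1 C1 C2 -> reaches T2 C1 C2.
Proof. by move=> le12 [t le_t <-]; exists t => //; lia. Qed.

Lemma reaches_step T C1 C2 C3 :
  step C1 = C2 -> reaches T C2 C3 -> reaches T.+1 C1 C3.
Proof. by move=> <- [t le_t <-]; exists t.+1 => //; rewrite iterSr. Qed.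

Definition running q := (q != tm_accept M) && (q != tm_reject M).

Lemma step_right q q' s s' l r :
  tm_delta q s = (q', s', MoveR) -> running q ->
  step (tape_at q l (s :: r)) = tape_at q' (s' :: l) r.
Proof.
by move=> E /andP[na nr]; rewrite /step /halted /= (negbTE na) (negbTE nr) /= E.
Qed.

Lemma step_left q q' s s' l r :
  tm_delta q s = (q', s', MoveL) -> running q ->
  step (tape_at q l (s :: r)) = tape_left q' l (s' :: r).
Proof.
by move=> E /andP[na nr]; rewrite /step /halted /= (negbTE na) (negbTE nr) /= E.
Qed.

Lemma step_stay q q' s s' l r :
  tm_delta q s = (q', s', Stay) -> running q ->
  step (tape_at q l (s :: r)) = tape_at q' l (s' :: r).
Proof.
by move=> E /andP[na nr]; rewrite /step /halted /= (negbTE na) (negbTE nr) /= E.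
Qed.

Lemma tape_at_blank q l b :
  tape_at q l (nseq b None) = tape_at q l (None :: nseq b.-1 None).
Proof. by case: b. Qed.

Lemma tape_left_blank q a r :
  tape_left q (nseq a None) r = tape_at q (nseq a.-1 None) (None :: r).
Proof. by case: a. Qed.

Lemma scan_right q u l r :
  running q -> (forall b, tm_delta q (Some b) = (q, Some b, MoveR)) ->
  reaches (size u) (tape_at q l (map Some u ++ r))
    (tape_at q (map Some (rev u) ++ l) r).
Proof.
move=> rq Eq; elim: u l => [|b u IH] l /=; first exact: reaches_refl.
apply: reaches_step (step_right _ _ (Eq b) rq) _.
by have := IH (Some b :: l); rewrite rev_cons map_rcons -cats1 -catA.
Qed.

Lemma scan_left q u l r :
  running q -> (forall b, tm_delta q (Some b) = (q, Some b, MoveL)) ->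
  reaches (size u) (tape_left q (map Some u ++ l) r)
    (tape_left q l (map Some (rev u) ++ r)).
Proof.
move=> rq Eq; elim: u r => [|b u IH] r /=; first exact: reaches_refl.
apply: reaches_step (step_left (map Some u ++ l) r (Eq b) rq) _.
by have := IH (Some b :: r); rewrite rev_cons map_rcons -cats1 -catA.
Qed.

End Reaches.

(** * Simulating sweeping transducers *)

Section Sweep.
Variables (cell reg : finType) (r0 : reg) (res : reg -> bool).
Definition action := reg -> cell -> reg * cell.

Fixpoint sweep_from (f : action) (r : reg) (s : seq cell) : reg * seq cell :=
  if s is c :: s' then
    let: (r1, c1) := f r c in
    let: (r2, s2) := sweep_from f r1 s' in (r2, c1 :: s2)
  else (r, [::]).

Definition sweep f s : bool * seq cell :=
  let: (r, s') := sweep_from f r0 s in (res r, s').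

Lemma size_sweep_from f r s : size (sweep_from f r s).2 = size s.
Proof.
elim: s r => //= c s IH r; case: (f r c) => r1 c1.
by have := IH r1; case: (sweep_from f r1 s) => r2 s2 /= ->.
Qed.

Lemma size_sweep f s : size (sweep f s).2 = size s.
Proof.
by have := size_sweep_from f r0 s; rewrite /sweep; case: (sweep_from f r0 s).
Qed.

Variables (Q : finType) (act : Q -> action) (nxt : Q -> bool -> option Q).

Fixpoint sweeps (k : nat) (q : Q) (s : seq cell) : option bool * seq cell :=
  if k is k'.+1 then
    let: (b, s') := sweep (act q) s in
    if nxt q b is Some q' then sweeps k' q' s' else (Some b, s')
  else (None, s).

Variables (q0 : Q) (inp : bool -> cell).
Variables (K : nat) (enc : cell -> seq bool) (dec : seq bool -> cell).
Hypotheses (K_gt0 : 0 < K) (size_enc : forall c, size (enc c) = K).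
Hypothesis encK : cancel enc dec.

(* A sweep moves the tape contents one block to the right: while a block is
   read, the new value of the previous block, held in the control ([carry]), is
   written over it.  So no block is visited twice in a sweep.  Before the first
   sweep the input is expanded, each bit being erased and a block appended to
   the right of the input. *)
Definition sim_state : finType :=
  (bool
   + (unit + bool + bool + {bseq K of bool} + unit + unit)
   + (Q * reg * ({bseq K of tsym} * {bseq K of bool} + {bseq K of tsym} + unit)))%type.

Definition stHalt b : sim_state := inl (inl b).
Definition stTake : sim_state := inl (inr (inl (inl (inl (inl (inl tt)))))).
Definition stOverInput b : sim_state := inl (inr (inl (inl (inl (inl (inr b)))))).
Definition stOverBlocks b : sim_state := inl (inr (inl (inl (inl (inr b))))).
Definition stEmit u : sim_state := inl (inr (inl (inl (inr (insub_bseq K u))))).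
Definition stBackBlocks : sim_state := inl (inr (inl (inr tt))).
Definition stBackInput : sim_state := inl (inr (inr tt)).
Definition stRead q r carry buf : sim_state :=
  inr (q, r, inl (inl (insub_bseq K carry, insub_bseq K buf))).
Definition stFlush q r carry : sim_state := inr (q, r, inl (inr (insub_bseq K carry))).
Definition stBack q r : sim_state := inr (q, r, inr tt).

Definition stStart q : sim_state := stRead q r0 (nseq K None) [::].

Definition sim_delta (st : sim_state) (x : tsym) : sim_state * tsym * move :=
  match st with
  | inl (inl b) => (stHalt b, x, Stay)
  | inl (inr (inl (inl (inl (inl (inl _)))))) =>
      if x is Some b then (stOverInput b, None, MoveR) else (stStart q0, None, MoveR)
  | inl (inr (inl (inl (inl (inl (inr b)))))) =>
      (if x is Some _ then stOverInput b else stOverBlocks b, x, MoveR)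
  | inl (inr (inl (inl (inl (inr b))))) =>
      if x is Some _ then (stOverBlocks b, x, MoveR)
      else (stEmit (enc (inp b)), None, Stay)
  | inl (inr (inl (inl (inr u)))) =>
      if bseqval u is b :: u' then (stEmit u', Some b, MoveR)
      else (stBackBlocks, x, MoveL)
  | inl (inr (inl (inr _))) =>
      (if x is Some _ then stBackBlocks else stBackInput, x, MoveL)
  | inl (inr (inr _)) =>
      if x is Some _ then (stBackInput, x, MoveL) else (stTake, x, MoveR)
  | inr (q, r, inl (inl (carry, buf))) =>
      if x is Some b then
        let buf' := rcons buf b in
        (if size buf' == K then
           let: (r', c) := act q r (dec buf') in stRead q r' (map Some (enc c)) [::]
         else stRead q r (behead carry) buf', head None carry, MoveR)
      else (stFlush q r carry, None, Stay)
  | inr (q, r, inl (inr carry)) =>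
      if bseqval carry is y :: carry' then (stFlush q r carry', y, MoveR)
      else (stBack q r, x, MoveL)
  | inr (q, r, inr _) =>
      if x is Some _ then (stBack q r, x, MoveL)
      else if nxt q (res r) is Some q' then (stStart q', None, MoveR)
      else (stHalt (res r), None, Stay)
  end.

Definition sim_TM : TM := Build_TM stTake (stHalt false) (stHalt true) sim_delta.

Let bseqK (T : Type) (u : seq T) : size u <= K -> insub_bseq K u = u :> seq T.
Proof. by move=> le_u; rewrite /insub_bseq /insubd insubT. Qed.

Definition blocks (s : seq cell) : seq bool := flatten (map enc s).

Lemma size_blocks s : size (blocks s) = K * size s.
Proof. by elim: s => [|c s IH] /=; rewrite ?muln0 // size_cat size_enc IH mulnS. Qed.

Definition start_config q s (C : config sim_TM) :=
  exists a b, C = @tape_at sim_TM (stStart q) (nseq a None)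
    (map Some (blocks s) ++ nseq b None).

Lemma read_block q r (carry : seq tsym) c l z :
  size carry = K ->
  @reaches sim_TM K
    (@tape_at sim_TM (stRead q r carry [::]) l (map Some (enc c) ++ z))
    (@tape_at sim_TM (stRead q (act q r c).1 (map Some (enc (act q r c).2)) [::])
       (rev carry ++ l) z).
Proof.
move=> sz_carry.
suff gen u buf (carry' : seq tsym) l' : buf ++ u = enc c -> u != [::] ->
    size carry' = size u ->
    @reaches sim_TM (size u)
      (@tape_at sim_TM (stRead q r carry' buf) l' (map Some u ++ z))
      (@tape_at sim_TM (stRead q (act q r c).1 (map Some (enc (act q r c).2)) [::])
        (rev carry' ++ l') z).
  rewrite -(size_enc c); apply: gen => //; last by rewrite size_enc.
  by rewrite -size_eq0 size_enc; lia.
elim: u buf carry' l' => //= b u IH buf [|y carry'] l' // Ebuf _ [sz].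
have szK := congr1 size Ebuf; rewrite size_cat /= size_enc in szK.
have Edelta : sim_delta (stRead q r (y :: carry') buf) (Some b) =
   (if size (rcons buf b) == K then
           let: (r', c) := act q r (dec (rcons buf b)) in
           stRead q r' (map Some (enc c)) [::]
    else stRead q r carry' (rcons buf b), y, MoveR).
  have le1 : size (y :: carry') <= K by move: szK sz => /=; lia.
  have le2 : size buf <= K by lia.
  by rewrite /sim_delta {1}/stRead (bseqK le1) (bseqK le2).
apply: reaches_step (@step_right sim_TM _ _ _ _ l' (map Some u ++ z) Edelta isT) _ => //.
rewrite size_rcons.
case: (altP (u =P [::])) => [u0|nz_u].
  have -> : carry' = [::] by move: sz; rewrite u0; case: (carry').
  have -> : ((size buf).+1 == K) = true by move: szK; rewrite u0 /=; lia.
  rewrite -cats1 -u0 /= in Ebuf *; move: Ebuf; rewrite u0 => ->; rewrite encK.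
  by case: (act q r c) => r' c' /=; apply: reaches_refl.
have -> : ((size buf).+1 == K) = false.
  by move: szK; case: (u) nz_u => //= *; lia.
by rewrite rev_cons cat_rcons; apply: IH; rewrite // cat_rcons.
Qed.

Lemma flush_carry q r (carry : seq tsym) l b :
  size carry <= K ->
  exists b', @reaches sim_TM (size carry).+1
    (@tape_at sim_TM (stFlush q r carry) l (nseq b None))
    (@tape_left sim_TM (stBack q r) (rev carry ++ l) (nseq b' None)).
Proof.
elim: carry l b => [|y carry IH] l b le_c.
  exists b.-1.+1; rewrite tape_at_blank.
  have E : sim_delta (stFlush q r [::]) None = (stBack q r, None, MoveL).
    by rewrite /sim_delta /stFlush bseqK.
  by apply: reaches_step (@step_left sim_TM _ _ _ _ l (nseq b.-1 None) E isT) _ => //;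
    apply: reaches_refl.
have [b' Hb'] := IH (y :: l) b.-1 (ltnW le_c).
exists b'; rewrite tape_at_blank.
have E : sim_delta (stFlush q r (y :: carry)) None = (stFlush q r carry, y, MoveR).
  by rewrite /sim_delta /stFlush bseqK.
apply: reaches_step (@step_right sim_TM _ _ _ _ l (nseq b.-1 None) E isT) _ => //.
by rewrite rev_cons cat_rcons.
Qed.

Lemma read_blocks q r (carry : seq tsym) s l b :
  size carry = K ->
  exists b', @reaches sim_TM (K * size s + K + 2)
    (@tape_at sim_TM (stRead q r carry [::]) l (map Some (blocks s) ++ nseq b None))
    (@tape_left sim_TM (stBack q (sweep_from (act q) r s).1)
       (rev (map Some (blocks (sweep_from (act q) r s).2)) ++ rev carry ++ l)
       (nseq b' None)).
Proof.
elim: s r carry l => [|c s IH] r carry l sz /=.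
  rewrite tape_at_blank.
  have [b' Hb'] := @flush_carry q r carry l b.-1.+1 (eq_leq sz).
  exists b'.
  have E : sim_delta (stRead q r carry [::]) None = (stFlush q r carry, None, Stay).
    by rewrite /sim_delta /stRead bseqK // sz.
  have {E}E := @step_stay sim_TM _ _ _ _ l (nseq b.-1 None) E isT.
  by apply: reaches_leq (reaches_step E Hb') => //; lia.
have H1 := read_block q r c l (map Some (blocks s) ++ nseq b None) sz.
case Ec: (act q r c) H1 => [r1 c1] /= H1.
have sz1 : size (map Some (enc c1)) = K by rewrite size_map size_enc.
have [b' H2] := IH r1 (map Some (enc c1)) (rev carry ++ l) sz1.
exists b'; case Es: (sweep_from (act q) r1 s) H2 => [r2 s2] /= H2.
rewrite /blocks /= !map_cat rev_cat -!catA in H1 *.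
by apply: reaches_leq (reaches_trans H1 H2); lia.
Qed.

Definition sweep_time L := K * L + K + 2 + (K * L + 1).

Lemma simulate_sweep q s C : start_config q s C ->
  let: (b, s') := sweep (act q) s in
  if nxt q b is Some q' then
    exists2 C', start_config q' s' C' & reaches (sweep_time (size s)) C C'
  else exists2 C' : config sim_TM, cstate C' = stHalt b &
    reaches (sweep_time (size s)) C C'.
Proof.
move=> [a [b ->]]; rewrite /sweep.
have szN : size (nseq K (@None bool)) = K by rewrite size_nseq.
have [b' H] := read_blocks q r0 s (nseq a None) b szN.
have := size_sweep_from (act q) r0 s.
case: (sweep_from (act q) r0 s) H => r s' /= H sz_s'.
have Ebk y : sim_delta (stBack q r) (Some y) = (stBack q r, Some y, MoveL) by [].
rewrite -map_rev in H.
have H2 := @scan_left sim_TM (stBack q r) (rev (blocks s'))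
  (rev (nseq K None) ++ nseq a None) (nseq b' None) isT Ebk.
have {H H2} := reaches_trans H H2.
rewrite revK rev_nseq -nseqD tape_left_blank size_rev size_blocks sz_s' => H.
have {}H T C' : reaches 1 (@tape_at sim_TM (stBack q r) (nseq (K + a).-1 None)
    (None :: map Some (blocks s') ++ nseq b' None)) C' -> T = sweep_time (size s) ->
  reaches T (@tape_at sim_TM (stStart q) (nseq a None)
    (map Some (blocks s) ++ nseq b None)) C'.
  by move=> H1 ->; apply: reaches_leq (reaches_trans H H1); rewrite /sweep_time; lia.
case Eq: (nxt q (res r)) => [q'|].
  have E : sim_delta (stBack q r) None = (stStart q', None, MoveR).
    by rewrite /sim_delta /stBack Eq.
  have {}E := @step_right sim_TM _ _ _ _ (nseq (K + a).-1 None)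
    (map Some (blocks s') ++ nseq b' None) E isT.
  eexists; last by apply: H => //; apply: reaches_step E (reaches_refl _ _).
  by exists (K + a).-1.+1, b'.
have E : sim_delta (stBack q r) None = (stHalt (res r), None, Stay).
  by rewrite /sim_delta /stBack Eq.
have {}E := @step_stay sim_TM _ _ _ _ (nseq (K + a).-1 None)
  (map Some (blocks s') ++ nseq b' None) E isT.
by eexists; last by apply: H => //; apply: reaches_step E (reaches_refl _ _).
Qed.

Lemma simulate_sweeps k q s C b s' :
  start_config q s C -> sweeps k q s = (Some b, s') ->
  exists2 C' : config sim_TM, cstate C' = stHalt b &
    reaches (k * sweep_time (size s)) C C'.
Proof.
elim: k q s C => //= k IH q s C /simulate_sweep.
have := size_sweep (act q) s; case: (sweep (act q) s) => b1 s1 /= sz.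
case: (nxt q b1) => [q'|] [C1 HC1 H1] Es.
  have [C2 HC2 H2] := IH _ _ _ HC1 Es.
  by exists C2 => //; rewrite mulSn -{2}sz; apply: reaches_trans H1 H2.
case: Es => <- _; exists C1 => //.
by apply: reaches_leq H1; rewrite mulSn leq_addr.
Qed.

Lemma emit_block u l b : size u <= K ->
  exists b', @reaches sim_TM (size u).+1
    (@tape_at sim_TM (stEmit u) l (nseq b None))
    (@tape_left sim_TM stBackBlocks (rev (map Some u) ++ l) (nseq b' None)).
Proof.
elim: u l b => [|y u IH] l b le_c.
  exists b.-1.+1; rewrite tape_at_blank.
  have E : sim_delta (stEmit [::]) None = (stBackBlocks, None, MoveL).
    by rewrite /sim_delta /stEmit bseqK.
  by apply: reaches_step (@step_left sim_TM _ _ _ _ l (nseq b.-1 None) E isT) _ => //;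
    apply: reaches_refl.
have [b' Hb'] := IH (Some y :: l) b.-1 (ltnW le_c).
exists b'; rewrite tape_at_blank.
have E : sim_delta (stEmit (y :: u)) None = (stEmit u, Some y, MoveR).
  by rewrite /sim_delta /stEmit bseqK.
apply: reaches_step (@step_right sim_TM _ _ _ _ l (nseq b.-1 None) E isT) _ => //.
by rewrite /= rev_cons cat_rcons.
Qed.

Definition take_config u s (C : config sim_TM) :=
  exists a b z,
    (forall q l, @tape_at sim_TM q l z =
       tape_at q l (None :: map Some (blocks s) ++ nseq b None)) /\
    C = @tape_at sim_TM stTake (nseq a None) (map Some u ++ z).

Lemma expand_bit x u s C : take_config (x :: u) s C ->
  exists2 C', take_config u (rcons s (inp x)) C' &
    reaches (2 * size u + 2 * K * (size s).+1 + 6) C C'.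
Proof.
move=> [a [b [z0 [Ez0 ->]]]]; pose z : seq tsym := nseq b None.
have E1 : sim_delta stTake (Some x) = (stOverInput x, None, MoveR) by [].
have E2 : sim_delta (stOverInput x) None = (stOverBlocks x, None, MoveR) by [].
have E3 : sim_delta (stOverBlocks x) None = (stEmit (enc (inp x)), None, Stay) by [].
have E4 : sim_delta stBackBlocks None = (stBackInput, None, MoveL) by [].
have E5 : sim_delta stBackInput None = (stTake, None, MoveR) by [].
have H1 := @scan_right sim_TM (stOverInput x) u (None :: nseq a None)
  z0 isT (fun _ => erefl).
rewrite Ez0 in H1.
have {E2} H2 := @step_right sim_TM _ _ _ _ (map Some (rev u) ++ nseq a.+1 None)
  (map Some (blocks s) ++ z) E2 isT.
set l1 := None :: map Some (rev u) ++ nseq a.+1 None in H2.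
have H3 := @scan_right sim_TM (stOverBlocks x) (blocks s) l1 z isT (fun _ => erefl).
rewrite /z tape_at_blank in H3.
have {E3} H4 := @step_stay sim_TM _ _ _ _ (map Some (rev (blocks s)) ++ l1)
  (nseq b.-1 None) E3 isT.
have [b' H5] := emit_block (map Some (rev (blocks s)) ++ l1) b.-1.+1
  (eq_leq (size_enc (inp x))).
have Eblocks : rev (map Some (enc (inp x))) ++ map Some (rev (blocks s)) ++ l1 =
  map Some (rev (blocks (rcons s (inp x)))) ++ l1.
  by rewrite /blocks map_rcons flatten_rcons rev_cat map_cat -catA -map_rev.
rewrite {}Eblocks in H5.
have H6 := @scan_left sim_TM stBackBlocks (rev (blocks (rcons s (inp x)))) l1
  (nseq b' None) isT (fun _ => erefl).
rewrite revK in H6; set z' := _ ++ nseq b' None in H6.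
have {E4} H7 := @step_left sim_TM _ _ _ _ (map Some (rev u) ++ nseq a.+1 None) z'
  E4 isT.
have H8 := @scan_left sim_TM stBackInput (rev u) (nseq a.+1 None) (None :: z')
  isT (fun _ => erefl).
rewrite revK tape_left_blank in H8.
have {E5} H9 := @step_right sim_TM _ _ _ _ (nseq a None)
  (map Some u ++ None :: z') E5 isT.
exists (@tape_at sim_TM stTake (nseq a.+1 None) (map Some u ++ None :: z')).
  by exists a.+1, b', (None :: z').
have H := reaches_trans H8 (reaches_step H9 (reaches_refl 0 _)).
have {}H := reaches_trans H6 (reaches_step H7 H).
have {}H := reaches_trans H3 (reaches_step H4 (reaches_trans H5 H)).
have {}H := reaches_trans H1 (reaches_step H2 H).
apply: reaches_leq (reaches_step _ H); last exact: (@step_right sim_TM _ _ _ _ _ _ E1 isT).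
by rewrite !size_rev !size_blocks size_rcons size_enc; lia.
Qed.

Lemma expand_input w s C : take_config w s C ->
  exists2 C', start_config q0 (s ++ map inp w) C' &
    reaches (size w * (2 * size w + 2 * K * (size s + size w) + 6) + 1) C C'.
Proof.
elim: w s C => [|x w IH] s C.
  move=> [a [b [z [Ez ->]]]]; rewrite cats0 /= Ez.
  have E : sim_delta stTake None = (stStart q0, None, MoveR) by [].
  eexists; last first.
    apply: reaches_step (reaches_refl _ _).
    by apply: (@step_right sim_TM _ _ _ _ _ _ E isT).
  by exists a.+1, b.
move=> /expand_bit[C1 /IH[C2 HC2 H2] H1]; exists C2; first by rewrite cat_rcons in HC2.
apply: reaches_leq (reaches_trans H1 H2); rewrite size_rcons /=.
nia.
Qed.

Definition sim_time k L := L * (2 * L + 2 * K * L + 6) + 1 + k * sweep_time L.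

Theorem sim_TM_correct w k b s' :
  sweeps k q0 (map inp w) = (Some b, s') ->
  exists t, t <= sim_time k (size w) /\ halted (run sim_TM w t) /\
    (cstate (run sim_TM w t) == tm_accept sim_TM) = ~~ b.
Proof.
move=> Es.
have : take_config w [::] (init sim_TM w).
  by exists 0, 0, [::]; split=> //; rewrite cats0; case: w {Es}.
move=> /expand_input[C1 HC1 [t1 le1 E1]].
have [C2 HC2 [t2 le2 E2]] := simulate_sweeps HC1 Es.
rewrite /= size_map in le2.
have Erun : run sim_TM w (t2 + t1) = C2 by rewrite /run iterD E1 E2.
exists (t2 + t1); split; first by rewrite /sim_time addnC leq_add.
by rewrite Erun /halted HC2; case: (b).
Qed.

End Sweep.

(** * Structured programs over sweeps *)

Definition sreg : finType := (bool * bool * bool)%type.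
Definition sreg0 : sreg := (false, false, false).
Definition sres (r : sreg) : bool := r.1.1.

Section Prog.
Variable cell : finType.
Notation act := (action cell sreg).
Notation sweepf := (@sweep cell sreg sreg0 sres).

Inductive prog :=
  | PSweep of act
  | PSeq of prog & prog
  | PIf of act & prog & prog
  | PWhile of act & prog.

Fixpoint pcT (p : prog) : finType :=
  match p with
  | PSweep _ => unit
  | PSeq p1 p2 => (pcT p1 + pcT p2)%type
  | PIf _ p1 p2 => option (pcT p1 + pcT p2)%type
  | PWhile _ p => option (pcT p)
  end.

Fixpoint pc_entry p : pcT p :=
  match p with
  | PSweep _ => tt
  | PSeq p1 p2 => inl (pc_entry p1)
  | PIf _ p1 p2 => None
  | PWhile _ p => None
  end.

Fixpoint pc_act p : pcT p -> act :=
  match p return pcT p -> act with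
  | PSweep f => fun _ => f
  | PSeq p1 p2 => fun pc =>
      match pc with inl pc1 => pc_act pc1 | inr pc2 => pc_act pc2 end
  | PIf f p1 p2 => fun pc =>
      match pc with
      | None => f
      | Some (inl pc1) => pc_act pc1
      | Some (inr pc2) => pc_act pc2
      end
  | PWhile f p => fun pc => if pc is Some pc1 then pc_act pc1 else f
  end.

Fixpoint pc_next p : pcT p -> bool -> option (pcT p) :=
  match p return pcT p -> bool -> option (pcT p) with
  | PSweep _ => fun _ _ => None
  | PSeq p1 p2 => fun pc b =>
      match pc with
      | inl pc1 => if pc_next pc1 b is Some pc' then Some (inl pc')
                   else Some (inr (pc_entry p2))
      | inr pc2 => omap inr (pc_next pc2 b)
      end
  | PIf f p1 p2 => fun pc b =>
      match pc with
      | None => Some (Some (if b then inl (pc_entry p1) else inr (pc_entry p2)))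
      | Some (inl pc1) => omap (fun pc' => Some (inl pc')) (pc_next pc1 b)
      | Some (inr pc2) => omap (fun pc' => Some (inr pc')) (pc_next pc2 b)
      end
  | PWhile f p => fun pc b =>
      match pc with
      | None => if b then Some (Some (pc_entry p)) else None
      | Some pc1 => if pc_next pc1 b is Some pc' then Some (Some pc') else Some None
      end
  end.

Notation psweeps p := (@sweeps cell sreg sreg0 sres (pcT p) (@pc_act p) (@pc_next p)).

(* [k] is an upper bound on the number of sweeps. *)
Definition exec p k s b s' := psweeps p k (pc_entry p) s = (Some b, s').

Lemma sweeps_leq (p : prog) k k' (pc : pcT p) s b s' : k <= k' ->
  psweeps p k pc s = (Some b, s') -> psweeps p k' pc s = (Some b, s').
Proof.
elim: k k' pc s => // k IH [|k'] pc s //= le_kk.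
by case: (sweepf _ s) => b1 s1; case: (pc_next pc b1) => // pc'; apply: IH.
Qed.

Lemma exec_leq p k k' s b s' : k <= k' -> exec p k s b s' -> exec p k' s b s'.
Proof. exact: sweeps_leq. Qed.

Lemma exec_sweep f s b s' : sweepf f s = (b, s') -> exec (PSweep f) 1 s b s'.
Proof. by rewrite /exec /= => ->. Qed.

(* A subprogram runs inside a larger program as on its own, up to the
   embedding [g] of its program counters, and then continues at [pc2]. *)
Lemma sweeps_embed (p p' : prog) (g : pcT p -> pcT p') (pc2 : pcT p') :
  (forall pc, pc_act (g pc) = pc_act pc) ->
  (forall pc b, pc_next (g pc) b = 
     Some (if pc_next pc b is Some pc' then g pc' else pc2)) ->
  forall k k2 pc s b s1 b' s2,
  psweeps p k pc s = (Some b, s1) -> psweeps p' k2 pc2 s1 = (Some b', s2) ->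
  psweeps p' (k + k2) (g pc) s = (Some b', s2).
Proof.
move=> Ea En; elim=> // k IH k2 pc s b s1 b' s2 /=.
rewrite Ea; case: (sweepf _ s) => b0 s0; rewrite En.
case: (pc_next pc b0) => [pc'|]; first exact: IH.
by case=> _ <-; apply: sweeps_leq; apply: leq_addl.
Qed.

Lemma sweeps_embed_exit (p p' : prog) (g : pcT p -> pcT p') :
  (forall pc, pc_act (g pc) = pc_act pc) ->
  (forall pc b, pc_next (g pc) b = omap g (pc_next pc b)) ->
  forall k pc s, psweeps p' k (g pc) s = psweeps p k pc s.
Proof.
move=> Ea En; elim=> // k IH pc s /=.
rewrite Ea; case: (sweepf _ s) => b0 s0; rewrite En.
by case: (pc_next pc b0) => [pc'|] //=; rewrite IH.
Qed.

Lemma exec_seq p1 p2 k1 k2 s b s1 b' s2 :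
  exec p1 k1 s b s1 -> exec p2 k2 s1 b' s2 -> exec (PSeq p1 p2) (k1 + k2) s b' s2.
Proof.
move=> H1 H2; rewrite /exec.
apply: (@sweeps_embed p1 (PSeq p1 p2) inl (inr (pc_entry p2)) _ _ k1 k2
          (pc_entry p1) s b s1) => //.
  by move=> pc b0 /=; case: (pc_next pc b0).
by rewrite (@sweeps_embed_exit p2 (PSeq p1 p2) inr).
Qed.

Lemma exec_if f p1 p2 k s b s1 b' s2 :
  sweepf f s = (b, s1) -> exec (if b then p1 else p2) k s1 b' s2 ->
  exec (PIf f p1 p2) k.+1 s b' s2.
Proof.
rewrite /exec /= => ->; case: b => H.
  by rewrite (@sweeps_embed_exit p1 (PIf f p1 p2) (fun pc => Some (inl pc))).
by rewrite (@sweeps_embed_exit p2 (PIf f p1 p2) (fun pc => Some (inr pc))).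
Qed.

Lemma exec_while_exit f p s s1 :
  sweepf f s = (false, s1) -> exec (PWhile f p) 1 s false s1.
Proof. by rewrite /exec /= => ->. Qed.

Lemma exec_while_loop f p k1 k2 s s1 b s2 b' s3 :
  sweepf f s = (true, s1) -> exec p k1 s1 b s2 -> exec (PWhile f p) k2 s2 b' s3 ->
  exec (PWhile f p) (k1 + k2).+1 s b' s3.
Proof.
rewrite /exec => E H1 H2 /=; rewrite E.
apply: (@sweeps_embed p (PWhile f p) Some None _ _ k1 k2 (pc_entry p) s1 b s2) => //.
by move=> pc b0 /=; case: (pc_next pc b0).
Qed.

Lemma sweep_mkseq (f : act) (r : nat -> sreg) (c c' : nat -> cell) L :
  r 0 = sreg0 -> (forall j, j < L -> f (r j) (c j) = (r j.+1, c' j)) ->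
  sweepf f (mkseq c L) = (sres (r L), mkseq c' L).
Proof.
move=> r00 Hf.
suff gen m i : i + m <= L ->
    sweep_from f (r i) [seq c j | j <- iota i m] =
    (r (i + m), [seq c' j | j <- iota i m]).
  by rewrite /sweep -r00 /mkseq gen.
elim: m i => [|m IH] i le_L /=; first by rewrite addn0.
by rewrite Hf ?IH ?addSnnS //; lia.
Qed.

End Prog.

(** * A language of bounded loops over the vertices *)

Definition upd (T : eqType) (U : Type) (f : T -> U) (x : T) (u : U) : T -> U :=
  fun y => if y == x then u else f y.

Section Actions.
Variable cell : finType.

Definition read_act (sel : pred cell) : action cell sreg :=
  fun r c => ((r.1.1 || sel c, false, false), c).

Definition map_act (g : cell -> cell) : action cell sreg := fun _ c => (sreg0, g c).

Lemma sweep_read sel (c : nat -> cell) L :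
  sweep sreg0 sres (read_act sel) (mkseq c L) =
  (has (fun j => sel (c j)) (iota 0 L), mkseq c L).
Proof.
rewrite (@sweep_mkseq _ (read_act sel)
  (fun i => (has (fun j => sel (c j)) (iota 0 i), false, false)) c c L) //.
by move=> j _; rewrite /read_act -[j.+1]addn1 iotaD has_cat /= orbF.
Qed.

Lemma sweep_map g (c : nat -> cell) L :
  sweep sreg0 sres (map_act g) (mkseq c L) = (false, mkseq (g \o c) L).
Proof. by rewrite (@sweep_mkseq _ _ (fun=> sreg0) c (g \o c)). Qed.

End Actions.

Section Language.
Variables V R Fl : finType.

Inductive bexp :=
  | BConst of bool
  | BAdj of V & V
  | BRel of R & V & V
  | BFlag of Fl
  | BNot of bexp
  | BAnd of bexp & bexp
  | BOr of bexp & bexp.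

Inductive cmd :=
  | CSkip
  | CSeq of cmd & cmd
  | CIf of bexp & cmd & cmd
  | CFor of V & cmd
  | CPut of R & V & V & bool
  | CPutF of Fl & bool.

Record store := Store { mrel : R -> nat -> nat -> bool; mflag : Fl -> bool }.

Definition put (m : store) r u v b :=
  Store (fun r' u' v' => if [&& r' == r, u' == u & v' == v] then b else mrel m r' u' v')
      (mflag m).
Definition putf (m : store) f b := Store (mrel m) (upd (mflag m) f b).

Section Semantics.
Variables (n : nat) (A : nat -> nat -> bool).

Fixpoint beval (b : bexp) (rho : V -> nat) (m : store) : bool :=
  match b with
  | BConst b => b
  | BAdj x y => A (rho x) (rho y)
  | BRel r x y => mrel m r (rho x) (rho y)
  | BFlag f => mflag m f
  | BNot b => ~~ beval b rho m
  | BAnd b1 b2 => beval b1 rho m && beval b2 rho m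
  | BOr b1 b2 => beval b1 rho m || beval b2 rho m
  end.

Fixpoint eval (c : cmd) (rho : V -> nat) (m : store) : store :=
  match c with
  | CSkip => m
  | CSeq c1 c2 => eval c2 rho (eval c1 rho m)
  | CIf b c1 c2 => if beval b rho m then eval c1 rho m else eval c2 rho m
  | CFor x c => foldl (fun m i => eval c (upd rho x i) m) m (iota 0 n)
  | CPut r x y b => put m r (rho x) (rho y) b
  | CPutF f b => putf m f b
  end.

End Semantics.

Fixpoint bvars (b : bexp) : seq V :=
  match b with
  | BConst _ | BFlag _ => [::]
  | BAdj x y | BRel _ x y => [:: x; y]
  | BNot b => bvars b
  | BAnd b1 b2 | BOr b1 b2 => bvars b1 ++ bvars b2
  end.

Fixpoint fvars (c : cmd) : seq V :=
  match c with
  | CSkip | CPutF _ _ => [::]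
  | CSeq c1 c2 => fvars c1 ++ fvars c2
  | CIf b c1 c2 => bvars b ++ fvars c1 ++ fvars c2
  | CFor x c => [seq y <- fvars c | y != x]
  | CPut _ x y _ => [:: x; y]
  end.

Fixpoint binders (c : cmd) : seq V :=
  match c with
  | CSkip | CPutF _ _ | CPut _ _ _ _ => [::]
  | CSeq c1 c2 | CIf _ c1 c2 => binders c1 ++ binders c2
  | CFor x c => x :: binders c
  end.

Fixpoint well_scoped (c : cmd) : bool :=
  match c with
  | CSkip | CPutF _ _ | CPut _ _ _ _ => true
  | CSeq c1 c2 | CIf _ c1 c2 => well_scoped c1 && well_scoped c2
  | CFor x c => (x \notin binders c) && well_scoped c
  end.

(* The [n ^ 2] cells are the positions [(j %/ n, j %% n)] of the adjacency
   matrix.  A variable [x] with value [v < n] is stored as the indicators of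
   row [v] and of column [v], so that entry [(x, y)] of a matrix is the one at
   the cell marked both by the row of [x] and by the column of [y]; the value
   [n] leaves no mark.  The pointer tracks only serve to compute [tStart]. *)
Definition track : finType := (unit + (bool * bool) + (V + V) + unit + R + Fl)%type.
Definition tStart : track := inl (inl (inl (inl (inl tt)))).
Definition tPtr i : track := inl (inl (inl (inl (inr i)))).
Definition tRow x : track := inl (inl (inl (inr (inl x)))).
Definition tCol x : track := inl (inl (inl (inr (inr x)))).
Definition tAdj : track := inl (inl (inr tt)).
Definition tRel r : track := inl (inr r).
Definition tFlag f : track := inr f.

Definition cell : finType := {ffun track -> bool}.

Definition mark (c : cell) (t : track) (b : bool) : cell :=
  [ffun t' => if t' == t then b else c t'].

Definition zero_act (x : V) : action cell sreg := fun r c =>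
  let first := if c tStart then ~~ r.1.2 else r.2 in
  ((false, true, first), mark (mark c (tRow x) first) (tCol x) (c tStart)).

Definition inc_act (x : V) : action cell sreg := fun r c =>
  let row := if c tStart then r.1.1 else r.1.2 in
  ((c (tRow x), row, c (tCol x)),
   mark (mark c (tRow x) row) (tCol x) (~~ c tStart && r.2)).

Definition sel_pair x y t (c : cell) := [&& c (tRow x), c (tCol y) & c t].

Fixpoint compile_if (b : bexp) (p1 p2 : prog cell) : prog cell :=
  match b with
  | BConst b => if b then p1 else p2
  | BAdj x y => PIf (read_act (sel_pair x y tAdj)) p1 p2
  | BRel r x y => PIf (read_act (sel_pair x y (tRel r))) p1 p2
  | BFlag f => PIf (read_act (fun c : cell => c (tFlag f))) p1 p2
  | BNot b => compile_if b p2 p1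
  | BAnd b1 b2 => compile_if b1 (compile_if b2 p1 p2) p2
  | BOr b1 b2 => compile_if b1 p1 (compile_if b2 p1 p2)
  end.

Fixpoint compile (c : cmd) : prog cell :=
  match c with
  | CSkip => PSweep (map_act id)
  | CSeq c1 c2 => PSeq (compile c1) (compile c2)
  | CIf b c1 c2 => compile_if b (compile c1) (compile c2)
  | CFor x c => PSeq (PSweep (zero_act x))
      (PWhile (read_act (fun c : cell => c (tRow x)))
         (PSeq (compile c) (PSweep (inc_act x))))
  | CPut r x y b => PSweep (map_act (fun c : cell =>
      if c (tRow x) && c (tCol y) then mark c (tRel r) b else c))
  | CPutF f b => PSweep (map_act (fun c : cell => mark c (tFlag f) b))
  end.

Fixpoint bcost (b : bexp) : nat :=
  match b with
  | BConst _ => 0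
  | BAdj _ _ | BRel _ _ _ | BFlag _ => 1
  | BNot b => bcost b
  | BAnd b1 b2 | BOr b1 b2 => bcost b1 + bcost b2
  end.

Fixpoint cost (n : nat) (c : cmd) : nat :=
  match c with
  | CSkip | CPut _ _ _ _ | CPutF _ _ => 1
  | CSeq c1 c2 => cost n c1 + cost n c2
  | CIf b c1 c2 => bcost b + (cost n c1 + cost n c2)
  | CFor x c => 1 + (n * (cost n c + 2) + 1)
  end.

Lemma cost_poly c : exists a d, forall n, cost n c <= a * n.+1 ^ d.
Proof.
have pow_ge d e n : d <= e -> n.+1 ^ d <= n.+1 ^ e by move=> ?; rewrite leq_pexp2l.
have pos d n : 0 < n.+1 ^ d by rewrite expn_gt0.
elim: c => [|c1 [a1 [d1 H1]] c2 [a2 [d2 H2]]|b c1 [a1 [d1 H1]] c2 [a2 [d2 H2]]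
           |x c [a [d H]]|r x y b|f b] /=.
- by exists 1, 0.
- exists (a1 + a2), (d1 + d2) => n; move: (H1 n) (H2 n).
  have := pow_ge _ _ n (leq_addr d2 d1); have := pow_ge _ _ n (leq_addl d1 d2).
  nia.
- exists (bcost b + a1 + a2), (d1 + d2) => n; move: (H1 n) (H2 n) (pos (d1 + d2) n).
  have := pow_ge _ _ n (leq_addr d2 d1); have := pow_ge _ _ n (leq_addl d1 d2).
  nia.
- exists (a + 2), d.+1 => n; move: (H n) (pos d n); rewrite expnS; nia.
- by exists 1, 0.
- by exists 1, 0.
Qed.

Section Tape.
Variables (n : nat) (A : nat -> nat -> bool).
Hypothesis n_gt0 : 0 < n.

Definition track_val (rho : V -> nat) (m : store) (j : nat) (t : track) : bool :=
  match t with
  | inl (inl (inl (inl (inl _)))) => j %% n == 0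
  | inl (inl (inl (inl (inr _)))) => false
  | inl (inl (inl (inr (inl x)))) => j %/ n == rho x
  | inl (inl (inl (inr (inr x)))) => j %% n == rho x
  | inl (inl (inr _)) => A (j %/ n) (j %% n)
  | inl (inr r) => mrel m r (j %/ n) (j %% n)
  | inr f => mflag m f
  end.

Definition cell_val rho m j : cell := [ffun t => track_val rho m j t].

Definition tape rho m := mkseq (cell_val rho m) (n * n).

Lemma eq_tape rho rho' m : rho =1 rho' -> tape rho m = tape rho' m.
Proof.
move=> E; apply: eq_mkseq => j; apply/ffunP=> t; rewrite !ffunE.
by case: t => [[[[[]|[x|x]]|]|]|] //=; rewrite E.
Qed.

Lemma cell_coords u v : u < n -> v < n ->
  [/\ u * n + v < n * n, (u * n + v) %/ n = u & (u * n + v) %% n = v].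
Proof.
move=> lt_u lt_v; rewrite divnMDl // divn_small // addn0 modnMDl modn_small //.
by split=> //; nia.
Qed.

Lemma sel_pairP rho m t x y (E : nat -> nat -> bool) : rho x < n -> rho y < n ->
  (forall j, cell_val rho m j t = E (j %/ n) (j %% n)) ->
  has (fun j => sel_pair x y t (cell_val rho m j)) (iota 0 (n * n)) =
  E (rho x) (rho y).
Proof.
move=> lt_x lt_y Et; have [lt_j Ediv Emod] := cell_coords lt_x lt_y.
apply/hasP/idP => [[j _ /and3P[]]|Exy].
  by rewrite Et !ffunE /= => /eqP <- /eqP <-.
exists (rho x * n + rho y); first by rewrite mem_iota.
by rewrite /sel_pair Et !ffunE /= Ediv Emod !eqxx.
Qed.

Lemma sweep_row rho m x :
  sweep sreg0 sres (read_act (fun c : cell => c (tRow x))) (tape rho m) =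
  (rho x < n, tape rho m).
Proof.
rewrite sweep_read; congr pair; apply/hasP/idP => [[j]|lt_x].
  by rewrite mem_iota ffunE /= => lt_j /eqP <-; rewrite ltn_divLR.
have [lt_j Ediv Emod] := cell_coords lt_x n_gt0.
by exists (rho x * n + 0); rewrite ?mem_iota ?ffunE /= ?Ediv.
Qed.

Lemma sweep_zero rho m x :
  exists b, sweep sreg0 sres (zero_act x) (tape rho m) = (b, tape (upd rho x 0) m).
Proof.
exists false.
rewrite /tape (@sweep_mkseq _ (zero_act x)
  (fun j => (false, 0 < j, (0 < j) && (j.-1 %/ n == 0)))
  _ (cell_val (upd rho x 0) m)) // => j _.
rewrite /zero_act !ffunE /=.
have -> : (if j %% n == 0 then ~~ (0 < j) else (0 < j) && (j.-1 %/ n == 0)) =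
          (j %/ n == 0).
  case: j => [|j] /=; first by rewrite mod0n div0n.
  by rewrite modnS divnS // ; case: (n %| j.+1) => //=; rewrite addn_eq0.
congr pair; apply/ffunP=> t; rewrite !ffunE.
case: t => [[[[[]|[y|y]]|]|]|] //=; rewrite ?ffunE //= /upd.
- by rewrite -[inl _ == _]/(y == x); case: eqP.
- by rewrite -[_ == tCol x]/(y == x); case: eqP.
Qed.

Lemma sweep_inc rho m x :
  exists b, sweep sreg0 sres (inc_act x) (tape rho m) =
    (b, tape (upd rho x (rho x).+1) m).
Proof.
exists (sres ((0 < n * n) && ((n * n).-1 %/ n == rho x), false, false)).
rewrite /tape (@sweep_mkseq _ (inc_act x)
  (fun j => ((0 < j) && (j.-1 %/ n == rho x), (0 < j) && (j.-1 %/ n == (rho x).+1),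
            (0 < j) && (j.-1 %% n == rho x)))
  _ (cell_val (upd rho x (rho x).+1) m)) // => j _.
rewrite /inc_act !ffunE /=.
have -> : (if j %% n == 0 then (0 < j) && (j.-1 %/ n == rho x)
           else (0 < j) && (j.-1 %/ n == (rho x).+1)) = (j %/ n == (rho x).+1).
  case: j => [|j] /=; first by rewrite mod0n div0n.
  by rewrite modnS divnS //; case: (n %| j.+1) => //=; rewrite add1n eqSS.
have -> : (j %% n != 0) && ((0 < j) && (j.-1 %% n == rho x)) = (j %% n == (rho x).+1).
  case: j => [|j] /=; first by rewrite mod0n.
  by rewrite modnS; case: (n %| j.+1).
congr pair; apply/ffunP=> t; rewrite !ffunE.
case: t => [[[[[]|[y|y]]|]|]|] //=; rewrite ?ffunE //= /upd.
- by rewrite -[inl _ == _]/(y == x); case: eqP.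
- by rewrite -[_ == tCol x]/(y == x); case: eqP.
Qed.

Lemma compile_if_correct b p1 p2 rho m k x s :
  {in bvars b, forall x, rho x < n} ->
  exec (if beval A b rho m then p1 else p2) k (tape rho m) x s ->
  exec (compile_if b p1 p2) (bcost b + k) (tape rho m) x s.
Proof.
elim: b p1 p2 k => [b|y z|r y z|f|b IH|b1 IH1 b2 IH2|b1 IH1 b2 IH2] p1 p2 k /= Hv H.
- by case: b H.
- apply: exec_if H; rewrite sweep_read (@sel_pairP _ _ _ _ _ A) ?Hv ?inE ?eqxx ?orbT //.
  by move=> j; rewrite ffunE.
- apply: exec_if H.
  rewrite sweep_read (@sel_pairP _ _ _ _ _ (mrel m r)) ?Hv ?inE ?eqxx ?orbT //.
  by move=> j; rewrite ffunE.
- apply: exec_if H; rewrite sweep_read; congr pair.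
  apply/hasP/idP => [[j _]|Hf]; first by rewrite ffunE.
  by exists 0; rewrite ?ffunE // mem_iota muln_gt0 n_gt0.
- by apply: IH => //; move: H; case: (beval A b rho m).
- have Hv1 : {in bvars b1, forall x, rho x < n}.
    by move=> y Hy; apply: Hv; rewrite mem_cat Hy.
  have Hv2 : {in bvars b2, forall x, rho x < n}.
    by move=> y Hy; apply: Hv; rewrite mem_cat Hy orbT.
  rewrite -addnA; apply: IH1 => //; case: (beval A b1 rho m) H => /= H.
    exact: IH2.
  by apply: exec_leq H; apply: leq_addl.
- have Hv1 : {in bvars b1, forall x, rho x < n}.
    by move=> y Hy; apply: Hv; rewrite mem_cat Hy.
  have Hv2 : {in bvars b2, forall x, rho x < n}.
    by move=> y Hy; apply: Hv; rewrite mem_cat Hy orbT.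
  rewrite -addnA; apply: IH1 => //; case: (beval A b1 rho m) H => /= H.
    by apply: exec_leq H; apply: leq_addl.
  exact: IH2.
Qed.

Theorem compile_correct c rho m :
  well_scoped c -> {in binders c, forall x, rho x = n} ->
  {in fvars c, forall x, rho x < n} ->
  exists b, exec (compile c) (cost n c) (tape rho m) b (tape rho (eval n A c rho m)).
Proof.
elim: c rho m => [|c1 IH1 c2 IH2|b c1 IH1 c2 IH2|x c IH|r x y b|f b] rho m /=.
- by exists false; apply: exec_sweep; rewrite sweep_map.
- move=> /andP[w1 w2] Hb Hf.
  have [||b1 H1] := IH1 rho m w1.
  + by move=> x Hx; apply: Hb; rewrite mem_cat Hx.
  + by move=> x Hx; apply: Hf; rewrite mem_cat Hx.
  have [||b2 H2] := IH2 rho (eval n A c1 rho m) w2.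
  + by move=> x Hx; apply: Hb; rewrite mem_cat Hx orbT.
  + by move=> x Hx; apply: Hf; rewrite mem_cat Hx orbT.
  by exists b2; apply: exec_seq H1 H2.
- move=> /andP[w1 w2] Hb Hf.
  have [||b1 H1] := IH1 rho m w1.
  + by move=> x Hx; apply: Hb; rewrite mem_cat Hx.
  + by move=> x Hx; apply: Hf; rewrite !mem_cat Hx orbT.
  have [||b2 H2] := IH2 rho m w2.
  + by move=> x Hx; apply: Hb; rewrite mem_cat Hx orbT.
  + by move=> x Hx; apply: Hf; rewrite !mem_cat Hx !orbT.
  have Hv : {in bvars b, forall x, rho x < n}.
    by move=> x Hx; apply: Hf; rewrite mem_cat Hx.
  exists (if beval A b rho m then b1 else b2); apply: compile_if_correct => //.
  case: (beval A b rho m); first by apply: exec_leq H1; apply: leq_addr.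
  by apply: exec_leq H2; apply: leq_addl.
- move=> /andP[nx w] Hb Hf.
  set body := fun m i => eval n A c (upd rho x i) m.
  have Hloop d i m0 : i + d = n ->
      exec (PWhile (read_act (fun c : cell => c (tRow x)))
             (PSeq (compile c) (PSweep (inc_act x)))) (d * (cost n c + 2) + 1)
        (tape (upd rho x i) m0) false (tape rho (foldl body m0 (iota i d))).
    have Ex j : upd rho x j x = j by rewrite /upd eqxx.
    elim: d i m0 => [|d IHd] i m0 Ei /=.
      have -> : tape rho m0 = tape (upd rho x i) m0.
        apply: eq_tape => y; rewrite /upd; case: eqP => // ->.
        by rewrite Hb ?mem_head // -Ei addn0.
      by apply: exec_while_exit; rewrite sweep_row Ex -Ei addn0 ltnn.
    have [||b1 H1] := IH (upd rho x i) m0 w.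
    + move=> y Hy; rewrite /upd; case: eqP => [Eyx|_].
        by rewrite -Eyx Hy in nx.
      by apply: Hb; rewrite inE Hy orbT.
    + move=> y Hy; rewrite /upd; case: eqP => [_|/eqP nyx]; first lia.
      by apply: Hf; rewrite mem_filter nyx.
    have [b2 H2] := sweep_inc (upd rho x i) (body m0 i) x.
    have H3 := IHd i.+1 (body m0 i) (etrans (addSnnS _ _) Ei).
    apply: exec_leq (exec_while_loop _ (exec_seq H1 (exec_sweep H2)) _); last first.
    + rewrite Ex; have -> : tape (upd (upd rho x i) x i.+1) (body m0 i) =
                  tape (upd rho x i.+1) (body m0 i).
        by apply: eq_tape => y; rewrite /upd; case: eqP.
      exact: H3.
    + by rewrite sweep_row Ex; congr pair; lia.
    + by rewrite mulSn; lia.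
  have [b0 H0] := sweep_zero rho m x.
  by exists false; apply: exec_seq (exec_sweep H0) (Hloop n 0 m (add0n n)).
- move=> _ _ _; exists false; apply: exec_sweep; rewrite sweep_map; congr pair.
  apply: eq_mkseq => j; apply/ffunP=> t; rewrite /= !ffunE /=.
  case: ifP => Hj; rewrite ?ffunE.
    case: t => [[[[[]|[]]|]|r']|] //=.
    by rewrite -[_ == tRel r]/(r' == r) Hj andbT.
  by case: t => [[[[[]|[]]|]|r']|] //=; rewrite Hj andbF.
- move=> _ _ _; exists false; apply: exec_sweep; rewrite sweep_map; congr pair.
  apply: eq_mkseq => j; apply/ffunP=> t; rewrite /= !ffunE /=.
  by case: t.
Qed.

End Tape.
End Language.

(** * Marking the row starts of the adjacency matrix *)

Definition runs (cell : finType) (p : prog cell) k s s' := exists b, exec p k s b s'.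

Lemma runs_leq (cell : finType) (p : prog cell) k k' s s' :
  k <= k' -> runs p k s s' -> runs p k' s s'.
Proof. by move=> le_k [b H]; exists b; apply: exec_leq H. Qed.

Lemma runs_seq (cell : finType) (p1 p2 : prog cell) k1 k2 s s1 s2 :
  runs p1 k1 s s1 -> runs p2 k2 s1 s2 -> runs (PSeq p1 p2) (k1 + k2) s s2.
Proof. by move=> [b1 H1] [b2 H2]; exists b2; apply: exec_seq H1 H2. Qed.

Section RowStarts.
Variables V R Fl : finType.
Notation cell := (cell V R Fl).
Notation prog := (prog cell).
Notation tPtr i := (@tPtr V R Fl i).
Notation tStart := (@tStart V R Fl).
Notation tAdj := (@tAdj V R Fl).

Notation pA := (false, false).
Notation pB := (false, true).
Notation pD := (true, false).
Notation pM := (true, true).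

Definition input_cell (b : bool) : cell := [ffun t => (t == tAdj) && b].

Definition first_act i : action cell sreg :=
  fun r c => ((false, true, false), mark c (tPtr i) (~~ r.1.2)).
Definition shift_act i : action cell sreg :=
  fun r c => ((false, false, c (tPtr i)), mark c (tPtr i) r.2).
Definition meet_act i i' : action cell sreg :=
  read_act (fun c : cell => c (tPtr i) && c (tPtr i')).
Definition live_act i : action cell sreg := read_act (fun c : cell => c (tPtr i)).
Definition start_act i : action cell sreg :=
  map_act (fun c : cell => mark c tStart (c tStart || c (tPtr i))).
Definition clear_act : action cell sreg := map_act (fun c : cell =>
  mark (mark (mark (mark c (tPtr pA) false) (tPtr pB) false) (tPtr pD) false)
    (tPtr pM) false).

Definition pseqs (fs : seq (action cell sreg)) (p : prog) : prog :=
  foldr (fun f p => PSeq (PSweep f) p) p fs.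

Section Pointers.
Variables (L : nat) (W : nat -> bool).

Definition ptr_val (S : nat -> bool) (P : bool * bool -> nat) (j : nat)
    (t : track V R Fl) : bool :=
  match t with
  | inl (inl (inl (inl (inl _)))) => S j
  | inl (inl (inl (inl (inr i)))) => j == P i
  | inl (inl (inr _)) => W j
  | _ => false
  end.

Definition ptr_tape S P := mkseq (fun j => [ffun t => ptr_val S P j t] : cell) L.

Lemma eq_ptr_tape S S' P P' : (forall j, j < L -> S j = S' j) -> P =1 P' ->
  ptr_tape S P = ptr_tape S' P'.
Proof.
move=> ES EP; apply/eq_in_map => j; rewrite mem_iota => lt_j.
by apply/ffunP=> t; rewrite !ffunE; case: t => [[[[[u|i]|x]|u]|r]|f] //=;
  rewrite ?ES ?EP.
Qed.

Lemma runs_first S P i : runs (PSweep (first_act i)) 1 (ptr_tape S P)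
  (ptr_tape S (upd P i 0)).
Proof.
eexists; apply: exec_sweep.
apply: (@sweep_mkseq _ (first_act i) (fun j => (false, 0 < j, false))) => // j _.
rewrite /first_act; congr pair; apply/ffunP=> t; rewrite !ffunE.
case: t => [[[[[u|i']|x]|u]|r]|f] //=.
rewrite -[_ == tPtr i]/(i' == i) /upd; case: eqP => // _.
by case: j.
Qed.

Lemma runs_shift S P i : runs (PSweep (shift_act i)) 1 (ptr_tape S P)
  (ptr_tape S (upd P i (P i).+1)).
Proof.
eexists; apply: exec_sweep.
apply: (@sweep_mkseq _ (shift_act i)
  (fun j => (false, false, (0 < j) && (j.-1 == P i)))) => // j _.
rewrite /shift_act !ffunE; congr pair; apply/ffunP=> t; rewrite !ffunE.
case: t => [[[[[u|i']|x]|u]|r]|f] //=.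
rewrite -[_ == tPtr i]/(i' == i) /upd; case: eqP => // _.
by case: j.
Qed.

Lemma runs_start S P i : runs (PSweep (start_act i)) 1 (ptr_tape S P)
  (ptr_tape (fun j => S j || (j == P i)) P).
Proof.
eexists; apply: exec_sweep; rewrite sweep_map; congr pair.
apply: eq_mkseq => j; apply/ffunP=> t; rewrite /= !ffunE.
by case: t => [[[[[u|i']|x]|u]|r]|f].
Qed.

Lemma sweep_meet S P i i' : P i < L ->
  sweep sreg0 sres (meet_act i i') (ptr_tape S P) = (P i == P i', ptr_tape S P).
Proof.
move=> lt_i; rewrite sweep_read; congr pair; apply/hasP/eqP => [[j _]|E].
  by rewrite !ffunE /= => /andP[/eqP <- /eqP].
by exists (P i); rewrite ?mem_iota // !ffunE /= E eqxx.
Qed.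

Lemma sweep_live S P i :
  sweep sreg0 sres (live_act i) (ptr_tape S P) = (P i < L, ptr_tape S P).
Proof.
rewrite sweep_read; congr pair; apply/hasP/idP => [[j]|lt_i].
  by rewrite mem_iota ffunE /= => lt_j /eqP <-.
by exists (P i); rewrite ?mem_iota // !ffunE /=.
Qed.

(* The loop ends when [pB] leaves the tape; [I b] describes the other tracks
   when [pB] is at [b]. *)
Lemma runs_while (I : nat -> (nat -> bool) -> (bool * bool -> nat) -> Prop) body k :
  (forall b S P, b < L -> P pB = b -> I b S P ->
     exists S' P', [/\ P' pB = b.+1, I b.+1 S' P' &
       runs body k (ptr_tape S P) (ptr_tape S' P')]) ->
  forall b S P, b <= L -> P pB = b -> I b S P ->
  exists S' P', [/\ P' pB = L, I L S' P' &
    runs (PWhile (live_act pB) body) (L * k.+1 + 1)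
      (ptr_tape S P) (ptr_tape S' P')].
Proof.
move=> Hbody b S P le_b EB HI.
suff [S' [P' [? ? H]]]: exists S' P', [/\ P' pB = L, I L S' P' &
    runs (PWhile (live_act pB) body) ((L - b) * k.+1 + 1)
      (ptr_tape S P) (ptr_tape S' P')].
  by exists S', P'; split=> //; apply: runs_leq H; nia.
have [d Ed] : exists d, d = L - b by exists (L - b).
rewrite -Ed; elim: d b S P le_b EB HI Ed => [|d IH] b S P le_b EB HI Ed.
  have Eb : b = L by lia.
  exists S, P; split; rewrite -?Eb //; exists false.
  by apply: exec_while_exit; rewrite sweep_live EB Eb ltnn.
have lt_b : b < L by lia.
have [S1 [P1 [EB1 HI1 [x H1]]]] := Hbody b S P lt_b EB HI.
have [|S2 [P2 [EB2 HI2 [y H2]]]] := IH b.+1 S1 P1 lt_b EB1 HI1; first lia.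
exists S2, P2; split=> //; exists y.
apply: exec_leq (exec_while_loop _ H1 H2); first by rewrite mulSn; lia.
by rewrite sweep_live EB lt_b.
Qed.

End Pointers.

(* Invariant of the first loop: [pB] = i ^ 2 + [pA] with [pA] <= [pD] = 2 i and
   [pM] = i - 1.  The pointer [pB] leaves the tape at n ^ 2, where i = n. *)
Definition root_prog : prog :=
  pseqs [:: first_act pA; first_act pB; shift_act pB; first_act pD;
            shift_act pD; shift_act pD; first_act pM]
    (PWhile (live_act pB)
      (PIf (meet_act pA pD)
        (pseqs [:: first_act pA; shift_act pD; shift_act pD; shift_act pM]
           (PSweep (shift_act pB)))
        (pseqs [:: shift_act pA] (PSweep (shift_act pB))))).

Definition rows_prog : prog :=
  pseqs [:: first_act pA; first_act pB; start_act pB]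
    (PSeq (PWhile (live_act pB)
      (PIf (meet_act pA pM)
        (pseqs [:: first_act pA; shift_act pB] (PSweep (start_act pB)))
        (pseqs [:: shift_act pA] (PSweep (shift_act pB)))))
      (PSweep clear_act)).

Lemma root_prog_correct n W P : 0 < n ->
  exists2 P', P' pM = n.-1 &
    runs root_prog (n * n * 7 + 8) (ptr_tape (n * n) W xpred0 P)
      (ptr_tape (n * n) W xpred0 P').
Proof.
move=> n_gt0.
pose I b (S : nat -> bool) (Q : bool * bool -> nat) := S = xpred0 /\
  exists i, [/\ 0 < i, b = i * i + Q pA, Q pA <= 2 * i, Q pD = 2 * i & Q pM = i.-1].
have Hbody b S Q : b < n * n -> Q pB = b -> I b S Q ->
     exists S' Q', [/\ Q' pB = b.+1, I b.+1 S' Q' &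
       runs (PIf (meet_act pA pD)
        (pseqs [:: first_act pA; shift_act pD; shift_act pD; shift_act pM]
           (PSweep (shift_act pB)))
        (pseqs [:: shift_act pA] (PSweep (shift_act pB)))) 6
        (ptr_tape (n * n) W S Q) (ptr_tape (n * n) W S' Q')].
  move=> lt_b EB [-> [i [i_gt0 Eb le_a ED EM]]].
  have lt_a : Q pA < n * n by lia.
  have Hm := sweep_meet W xpred0 pD lt_a.
  case Ea: (Q pA == Q pD) Hm => Hm.
    have := runs_seq (runs_first (n * n) W xpred0 Q pA) (runs_seq (runs_shift _ _ _ _ pD)
      (runs_seq (runs_shift _ _ _ _ pD) (runs_seq (runs_shift _ _ _ _ pM)
      (runs_shift _ _ _ _ pB)))).
    set Q' := upd _ pB _; move=> [x Hx]; exists xpred0, Q'; split.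
    - by rewrite /Q' /upd /= EB.
    - split=> //; exists i.+1; rewrite /Q' /upd /=; move/eqP: Ea => Ea.
      by split; lia.
    - by exists x; apply: exec_if Hm _.
  have := runs_seq (runs_shift (n * n) W xpred0 Q pA) (runs_shift _ _ _ _ pB).
  set Q' := upd _ pB _; move=> [x Hx]; exists xpred0, Q'; split.
  - by rewrite /Q' /upd /= EB.
  - split=> //; exists i; rewrite /Q' /upd /=; move/eqP: Ea => Ea.
    by split; lia.
  - by exists x; apply: exec_leq (exec_if Hm Hx).
have [P1 EP1 H0] : exists2 P1, [/\ P1 pA = 0, P1 pB = 1, P1 pD = 2 & P1 pM = 0] &
    forall p k s', runs p k (ptr_tape (n * n) W xpred0 P1) s' ->
      runs (pseqs [:: first_act pA; first_act pB; shift_act pB; first_act pD;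
            shift_act pD; shift_act pD; first_act pM] p) (7 + k)
        (ptr_tape (n * n) W xpred0 P) s'.
  pose Q1 := upd (upd P pA 0) pB 0; pose Q2 := upd Q1 pB (Q1 pB).+1.
  pose Q3 := upd Q2 pD 0; pose Q4 := upd Q3 pD (Q3 pD).+1.
  pose Q5 := upd Q4 pD (Q4 pD).+1; exists (upd Q5 pM 0) => // p k s' H.
  exact: runs_seq (runs_first (n * n) W xpred0 P pA)
     (runs_seq (runs_first _ _ _ _ pB) (runs_seq (runs_shift _ _ _ Q1 pB)
     (runs_seq (runs_first _ _ _ Q2 pD) (runs_seq (runs_shift _ _ _ Q3 pD)
     (runs_seq (runs_shift _ _ _ Q4 pD) (runs_seq (runs_first _ _ _ Q5 pM) H)))))).
case: EP1 => EA EB ED EM.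
have [||S' [P' [EB' [-> [i [i_gt0 Ei le_a ED' EM']]] H]]] :=
  runs_while Hbody (b := 1) _ EB (S := xpred0).
- by rewrite muln_gt0 n_gt0.
- by split=> //; exists 1; rewrite EA ED EM.
exists P'; first by rewrite EM'; nia.
by apply: runs_leq (H0 _ _ _ H); lia.
Qed.

Lemma rows_prog_correct n A P (m0 : store R Fl) : 0 < n -> P pM = n.-1 ->
  (forall r u v, mrel m0 r u v = false) -> (forall f, mflag m0 f = false) ->
  runs rows_prog (n * n * 5 + 5)
    (ptr_tape (n * n) (fun j => A (j %/ n) (j %% n)) xpred0 P)
    (@tape V R Fl n A (fun=> n) m0).
Proof.
move=> n_gt0 EM rel0 flag0; set W := fun j => _.
have lt_n : n <= n * n by nia.
pose I b (S : nat -> bool) (Q : bool * bool -> nat) :=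
  [/\ S =1 (fun j => (j %% n == 0) && (j <= b)), Q pA = b %% n & Q pM = n.-1].
have Hbody b S Q : b < n * n -> Q pB = b -> I b S Q ->
     exists S' Q', [/\ Q' pB = b.+1, I b.+1 S' Q' &
       runs (PIf (meet_act pA pM)
        (pseqs [:: first_act pA; shift_act pB] (PSweep (start_act pB)))
        (pseqs [:: shift_act pA] (PSweep (shift_act pB)))) 4
        (ptr_tape (n * n) W S Q) (ptr_tape (n * n) W S' Q')].
  move=> lt_b EB [ES EA EM'].
  have lt_a : Q pA < n * n by rewrite EA; have := ltn_pmod b n_gt0; lia.
  have Hm := sweep_meet W S pM lt_a.
  have Emod : b.+1 %% n = if Q pA == Q pM then 0 else (Q pA).+1.
    rewrite EA EM' modnS; have := ltn_pmod b n_gt0.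
    have := divn_eq b n; move: (b %/ n) (b %% n) => q r -> lt_r.
    have -> : (n %| (q * n + r).+1) = (n %| r.+1).
      by rewrite -addnS dvdn_addr // dvdn_mull.
    case: eqP => [->|ne]; first by rewrite prednK // dvdnn.
    by rewrite gtnNdvd //; lia.
  case Ea: (Q pA == Q pM) Hm Emod => Hm Emod.
    have := runs_seq (runs_first (n * n) W S Q pA)
      (runs_seq (runs_shift _ _ _ _ pB) (runs_start _ _ _ _ pB)).
    set Q' := upd _ pB _; move=> [x Hx].
    have EB1 : Q' pB = b.+1 by rewrite /Q' /upd /= EB.
    exists (fun j => S j || (j == Q' pB)), Q'; split=> //.
    - split; [|by rewrite /Q' /upd /= Emod|by rewrite /Q' /upd /=].
      move=> j; rewrite ES EB1 [j <= b.+1]leq_eqVlt.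
      case: (j =P b.+1) => [->|_]; first by rewrite Emod eqxx orbT.
      by rewrite orbF.
    - by exists x; apply: exec_if Hm _.
  have := runs_seq (runs_shift (n * n) W S Q pA) (runs_shift _ _ _ _ pB).
  set Q' := upd _ pB _; move=> [x Hx]; exists S, Q'; split.
  - by rewrite /Q' /upd /= EB.
  - split; [|by rewrite /Q' /upd /= Emod|by rewrite /Q' /upd /=].
    move=> j; rewrite ES [j <= b.+1]leq_eqVlt.
    by case: (j =P b.+1) => [->|_] //; rewrite Emod.
  - by exists x; apply: exec_leq (exec_if Hm Hx).
have [P1 [EP1 EA EB] H0] : exists2 P1, [/\ P1 pM = n.-1, P1 pA = 0 & P1 pB = 0] &
    forall p k s', runs p k
        (ptr_tape (n * n) W (fun j => (j %% n == 0) && (j <= 0)) P1) s' ->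
      runs (pseqs [:: first_act pA; first_act pB; start_act pB] p) (3 + k)
        (ptr_tape (n * n) W xpred0 P) s'.
  exists (upd (upd P pA 0) pB 0) => // p k s' H.
  apply: runs_seq (runs_first (n * n) W xpred0 P pA)
     (runs_seq (runs_first _ _ _ _ pB) (runs_seq (runs_start _ _ _ _ pB) _)).
  rewrite (@eq_ptr_tape (n * n) W _ (fun j => (j %% n == 0) && (j <= 0)) _
      (upd (upd P pA 0) pB 0)) //.
  by move=> [|j] _ /=; rewrite ?mod0n ?andbF.
have [||S' [P' [EB' [ES' _ _] H]]] := runs_while Hbody (b := 0) _ EB
  (S := fun j => (j %% n == 0) && (j <= 0)) => //.
- by split=> //; rewrite mod0n.
have Hc : runs (PSweep clear_act) 1 (ptr_tape (n * n) W S' P')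
    (@tape V R Fl n A (fun=> n) m0).
  exists false; apply: exec_sweep; rewrite sweep_map; congr pair.
  apply/eq_in_map => j; rewrite mem_iota => /= lt_j.
  apply/ffunP=> t; rewrite /= !ffunE.
  case: t => [[[[[u|[[] []]]|[x|x]]|u]|r]|f] //=.
  - by rewrite ES' (ltnW lt_j) andbT.
  - by apply/esym/eqP=> E; move: lt_j; rewrite -ltn_divLR // E ltnn.
  - by apply/esym/eqP=> E; have := ltn_pmod j n_gt0; rewrite E ltnn.
by apply: runs_leq (H0 _ _ _ (runs_seq H Hc)); lia.
Qed.

Definition setup_prog : prog := PSeq root_prog rows_prog.

Theorem setup_prog_correct n A (m0 : store R Fl) : 0 < n ->
  (forall r u v, mrel m0 r u v = false) -> (forall f, mflag m0 f = false) ->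
  runs setup_prog (n * n * 12 + 13)
    (map input_cell (mkseq (fun j => A (j %/ n) (j %% n)) (n * n)))
    (@tape V R Fl n A (fun=> n) m0).
Proof.
move=> n_gt0 rel0 flag0; set W := fun j => _.
have -> : map input_cell (mkseq W (n * n)) = ptr_tape (n * n) W xpred0 (fun=> n * n).
  rewrite /mkseq -map_comp; apply/eq_in_map => j; rewrite mem_iota => /= lt_j.
  apply/ffunP=> t; rewrite !ffunE.
  case: t => [[[[[u|i]|x]|u]|r]|f] //=; by rewrite (ltn_eqF lt_j).
have [P' EM H1] := root_prog_correct W (fun=> n * n) n_gt0.
apply: runs_leq (runs_seq H1 (rows_prog_correct A n_gt0 EM rel0 flag0)); lia.
Qed.

End RowStarts.

(** * Loops that only set bits *)

Section Monotone.
Variables (V R Fl : finType) (n : nat) (A : nat -> nat -> bool).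
Notation cmd := (cmd V R Fl).
Notation store := (store R Fl).
Notation eval := (@eval V R Fl n A).

Definition cseqs (s : seq cmd) : cmd := foldr (@CSeq V R Fl) (@CSkip V R Fl) s.
Definition cfors (xs : seq V) (c : cmd) : cmd := foldr (@CFor V R Fl) c xs.
Definition bany (s : seq (bexp V R Fl)) := foldr (@BOr V R Fl) (BConst _ _ _ false) s.
Definition ball (s : seq (bexp V R Fl)) := foldr (@BAnd V R Fl) (BConst _ _ _ true) s.

Lemma beval_bany (T : Type) (F : T -> bexp V R Fl) s rho m :
  beval A (bany [seq F t | t <- s]) rho m = has (fun t => beval A (F t) rho m) s.
Proof. by elim: s => //= t s ->. Qed.

Lemma beval_ball (T : Type) (F : T -> bexp V R Fl) s rho m :
  beval A (ball [seq F t | t <- s]) rho m = all (fun t => beval A (F t) rho m) s.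
Proof. by elim: s => //= t s ->. Qed.

Lemma eval_seq c1 c2 rho m : eval (CSeq c1 c2) rho m = eval c2 rho (eval c1 rho m).
Proof. by []. Qed.

Lemma eval_if b c1 c2 rho m :
  eval (CIf b c1 c2) rho m = if beval A b rho m then eval c1 rho m else eval c2 rho m.
Proof. by []. Qed.

Lemma for_inv (P : store -> Prop) x c rho :
  (forall i m, i < n -> P m -> P (eval c (upd rho x i) m)) ->
  forall m, P m -> P (eval (CFor x c) rho m).
Proof.
move=> Hc m Hm /=; have: all (gtn n) (iota 0 n).
  by apply/allP=> i; rewrite mem_iota.
by elim: (iota 0 n) m Hm => //= i s IH m Hm /andP[lt_i /IH]; apply; apply: Hc.
Qed.

Lemma seqs_inv (T : eqType) (P : store -> Prop) (F : T -> cmd) s rho :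
  (forall t m, t \in s -> P m -> P (eval (F t) rho m)) ->
  forall m, P m -> P (eval (cseqs [seq F t | t <- s]) rho m).
Proof.
elim: s => //= t s IH Hs m Hm; apply: IH => [t' m' st'|].
  by apply: Hs; rewrite inE st' orbT.
by apply: Hs; rewrite ?mem_head.
Qed.

Lemma for_est (P : store -> Prop) x c rho i0 : i0 < n ->
  (forall m, P (eval c (upd rho x i0) m)) ->
  (forall i m, i < n -> P m -> P (eval c (upd rho x i) m)) ->
  forall m, P (eval (CFor x c) rho m).
Proof.
move=> lt_i0 H0 Hc m /=; have: i0 \in iota 0 n by rewrite mem_iota.
have: all (gtn n) (iota 0 n) by apply/allP=> i; rewrite mem_iota.
elim: (iota 0 n) m => //= i s IH m /andP[lt_i lt_s].
rewrite inE => /predU1P[<-|]; last exact: IH.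
elim: s lt_s (eval _ _ _) (H0 m) {IH} => //= j s IH /andP[lt_j lt_s] m' Hm'.
by apply: IH => //; apply: Hc.
Qed.

Lemma seqs_est (T : eqType) (P : store -> Prop) (F : T -> cmd) s rho t0 : t0 \in s ->
  (forall m, P (eval (F t0) rho m)) ->
  (forall t m, P m -> P (eval (F t) rho m)) ->
  forall m, P (eval (cseqs [seq F t | t <- s]) rho m).
Proof.
move=> + H0 Hs; elim: s => //= t s IH; rewrite inE => /predU1P[<-|/IH H] m //.
by apply: seqs_inv => // t' m' _; apply: Hs.
Qed.

Fixpoint setting (c : cmd) : bool :=
  match c with
  | CSkip => true
  | CSeq c1 c2 | CIf _ c1 c2 => setting c1 && setting c2
  | CFor _ c => setting c
  | CPut _ _ _ b | CPutF _ b => b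
  end.

Fixpoint keeps (f : Fl) (c : cmd) : bool :=
  match c with
  | CSkip | CPut _ _ _ _ => true
  | CSeq c1 c2 | CIf _ c1 c2 => keeps f c1 && keeps f c2
  | CFor _ c => keeps f c
  | CPutF f' _ => f' != f
  end.

Definition store_le (m m' : store) :=
  (forall r u v, mrel m r u v -> mrel m' r u v) /\ (forall f, mflag m f -> mflag m' f).

Lemma store_le_refl m : store_le m m. Proof. by []. Qed.

Lemma store_le_trans m1 m2 m3 : store_le m1 m2 -> store_le m2 m3 -> store_le m1 m3.
Proof. by move=> [H1 H1'] [H2 H2']; split=> *; [apply/H2/H1 | apply/H2'/H1']. Qed.

Lemma setting_le c rho m : setting c -> store_le m (eval c rho m).
Proof.
elim: c rho m => [|c1 IH1 c2 IH2|b c1 IH1 c2 IH2|x c IH|r x y b|f b] rho m //=.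
- by case/andP=> /(IH1 rho m) H1 /(IH2 rho (eval c1 rho m)); apply: store_le_trans.
- by case/andP=> /(IH1 rho m) H1 /(IH2 rho m) H2; case: ifP.
- move=> Hc; have H : store_le m m by [].
  by apply: (@for_inv (store_le m)) H => i m' _ /store_le_trans; apply; apply: IH.
- by move=> ->; split=> //= *; case: ifP.
- by move=> ->; split=> //= *; rewrite /upd; case: ifP.
Qed.

Lemma keeps_flag f c rho m : keeps f c -> mflag (eval c rho m) f = mflag m f.
Proof.
elim: c rho m => [|c1 IH1 c2 IH2|b c1 IH1 c2 IH2|x c IH|r x y b|f' b] rho m //=.
- by case/andP=> H1 H2; rewrite IH2 // IH1.
- by case/andP=> H1 H2; case: ifP => _; rewrite ?IH1 ?IH2.
- move=> Hc; apply: (@for_inv (fun m' => mflag m' f = mflag m f)) => // i m' _ <-.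
  exact: IH.
- by rewrite /upd eq_sym => /negbTE->.
Qed.

(* Running [c] runs [c0] in environment [rho0] at some intermediate point. *)
Definition hits c rho c0 rho0 := forall m, exists2 m', store_le m m' &
  store_le (eval c0 rho0 m') (eval c rho m).

Lemma hits_refl c rho : hits c rho c rho.
Proof. by move=> m; exists m. Qed.

Lemma hits_for x c rho c0 rho0 i : setting c -> i < n ->
  hits c (upd rho x i) c0 rho0 -> hits (CFor x c) rho c0 rho0.
Proof.
move=> sc lt_i Hc m /=; have: i \in iota 0 n by rewrite mem_iota.
have mono s m' : store_le m' (foldl (fun m i => eval c (upd rho x i) m) m' s).
  elim: s m' => //= j s IH m'; apply: store_le_trans _ (IH _); exact: setting_le.
elim: (iota 0 n) m => //= j s IH m; rewrite inE => /predU1P[<-|/IH{}IH].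
  by have [m' Hm' H] := Hc m; exists m' => //; apply: store_le_trans H (mono _ _).
have [m' Hm' H] := IH (eval c (upd rho x j) m).
by exists m' => //; apply: store_le_trans _ Hm'; apply: setting_le.
Qed.

Lemma hits_seqs (T : eqType) (F : T -> cmd) s rho c0 rho0 t :
  (forall t, setting (F t)) -> t \in s ->
  hits (F t) rho c0 rho0 -> hits (cseqs [seq F t | t <- s]) rho c0 rho0.
Proof.
move=> sF + Ht; elim: s => //= t' s IH; rewrite inE => /predU1P[<-|/IH H] m /=.
  have [m' Hm' H] := Ht m; exists m' => //; apply: store_le_trans H _.
  by apply: setting_le; elim: (s) => //= *; rewrite sF.
by have [m' Hm' H'] := H (eval (F t') rho m); exists m' => //;
  apply: store_le_trans _ Hm'; apply: setting_le.
Qed.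

Lemma hits_seq c1 c2 rho c0 rho0 : setting c1 ->
  hits c2 rho c0 rho0 -> hits (CSeq c1 c2) rho c0 rho0.
Proof.
move=> sc H m /=; have [m' Hm' H'] := H (eval c1 rho m); exists m' => //.
by apply: store_le_trans _ Hm'; apply: setting_le.
Qed.

Lemma hits_if b c1 c2 rho c0 rho0 : (forall m, beval A b rho m) ->
  hits c1 rho c0 rho0 -> hits (CIf b c1 c2) rho c0 rho0.
Proof. by move=> Hb H m /=; rewrite Hb. Qed.

Lemma cfors_reach_flag f xs c rho rhos ys :
  (forall rho' m, mflag m f -> mflag (eval c rho' m) f) ->
  {in ys, rho =1 rhos} -> {in xs, forall x, rhos x < n} ->
  (forall rho' m, {in ys ++ xs, rho' =1 rhos} -> mflag (eval c rho' m) f) ->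
  forall m, mflag (eval (cfors xs c) rho m) f.
Proof.
move=> mono; elim: xs ys rho => [|x xs IH] ys rho Hys Hxs Hc m /=.
  by apply: Hc; rewrite cats0.
apply: (@for_est (fun m => mflag m f) x (cfors xs c) rho (rhos x)).
- by apply: Hxs; rewrite mem_head.
- move=> m'; apply: (IH (x :: ys)) => [y|y Hy|rho' m1 Hrho'].
  + by rewrite inE /upd; case: eqP => [->|_ /Hys].
  + by apply: Hxs; rewrite inE Hy orbT.
  + apply: Hc => y; rewrite mem_cat inE orbCA => Hy; apply: Hrho'.
    by rewrite inE mem_cat.
- move=> i m' _; elim: (xs) (upd rho x i) m' => [|x' xs' IH'] rho' m' /= Hm'.
    exact: mono.
  by apply: (@for_inv (fun m => mflag m f)) => // j m1 _; apply: IH'.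
Qed.

Lemma cfors_flag_reached f xs c rho m : ~~ mflag m f -> mflag (eval (cfors xs c) rho m) f ->
  exists rho' m', ~~ mflag m' f /\ mflag (eval c rho' m') f.
Proof.
elim: xs rho m => [|x xs IH] rho m Hm /=; first by exists rho, m.
elim: (iota 0 n) m Hm => /= [|i s IHs] m Hm; first by rewrite (negbTE Hm).
case: (boolP (mflag (eval (cfors xs c) (upd rho x i) m) f)) => [H _|]; last exact: IHs.
exact: IH Hm H.
Qed.

End Monotone.

(** * The colouring algorithm *)

Definition color : finType := option bool.
Definition colors : seq color := [:: None; Some false; Some true].
Definition cpairs : seq (color * color) := [seq (c, d) | c <- colors, d <- colors].

Lemma mem_colors c : c \in colors.
Proof. by case: c => [[]|]. Qed.

Lemma mem_cpairs cd : cd \in cpairs.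
Proof. by case: cd => [[[]|] [[]|]]. Qed.

Lemma third_color (p q : color) : exists r : color, (r != p) && (r != q).
Proof.
by case: p q => [[]|] [[]|];
  first [by exists None | by exists (Some true) | by exists (Some false)].
Qed.

Lemma two_colors (p q r c : color) : p != q -> r != p -> r != q -> c != r ->
  (c == p) || (c == q).
Proof. by case: p q r c => [[]|] [[]|] [[]|] [[]|]. Qed.

(* The variable [vg p q] holds the guessed vertex of colour [p] with the most
   neighbours of colour [q]; the bit [(c, d)] at [(u, v)] forbids the colours
   [c] for [u] and [d] for [v] at the same time. *)
Definition cvar : finType := (color * color + bool * bool)%type.
Definition vg p q : cvar := inl (p, q).
Definition v1 : cvar := inr (false, false).
Definition v2 : cvar := inr (false, true).
Definition v3 : cvar := inr (true, false).
Definition v4 : cvar := inr (true, true).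
Definition crel : finType := (color * color)%type.
Definition cflag : finType := bool.
Notation fFail := false (only parsing).
Notation fAcc := true (only parsing).

Notation cexp := (bexp cvar crel cflag).
Notation ccmd := (cmd cvar crel cflag).
Notation EConst b := (@BConst cvar crel cflag b).
Notation EAdj x y := (@BAdj cvar crel cflag x y).
Notation ERel c d x y := (@BRel cvar crel cflag (c, d) x y).
Notation ESym c d x y := (BOr (ERel c d x y) (ERel d c y x)).
Notation Put c d x y b := (@CPut cvar crel cflag (c, d) x y b).
Notation PutF f b := (@CPutF cvar crel cflag f b).
Notation Skip := (@CSkip cvar crel cflag).

Definition bad_exp c x : cexp :=
  BOr (bany [seq EAdj x (vg c q) | q <- colors])
      (BAnd (EConst (c != None))
         (BNot (bany [seq EAdj x (vg pq.1 pq.2) | pq <- cpairs]))).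

Definition base_exp c d x y : cexp :=
  BOr (BOr (bad_exp c x) (bad_exp d y))
      (BAnd (EAdj x y) (BOr (EConst (c == d))
         (BOr (BNot (EAdj x (vg d c))) (BNot (EAdj y (vg c d)))))).

Definition init_cmd : ccmd :=
  CFor v1 (CFor v2 (cseqs [seq CIf (base_exp cd.1 cd.2 v1 v2)
    (Put cd.1 cd.2 v1 v2 true) (Put cd.1 cd.2 v1 v2 false) | cd <- cpairs])).

Definition matching_exp : cexp :=
  BAnd (BAnd (EAdj v1 v2) (EAdj v3 v4))
    (BAnd (BAnd (BNot (EAdj v1 v3)) (BNot (EAdj v1 v4)))
          (BAnd (BNot (EAdj v2 v3)) (BNot (EAdj v2 v4)))).

Definition triples : seq (color * color * color) :=
  [seq (pq, r) | pq <- cpairs, r <- colors].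

Lemma mem_triples t : t \in triples.
Proof. by case: t => [[[[]|] [[]|]] [[]|]]. Qed.

(* If [v1] has colour [p <> r] and this excludes colour [r] for [v2], then the
   edge avoids colour [r]; two edges of an induced 2K2 may not both do so. *)
Definition rule_body t : ccmd :=
  CIf (BAnd (EConst ((t.2 != t.1.1) && (t.2 != t.1.2)))
            (BAnd (ERel t.1.1 t.2 v1 v2) (ERel t.1.2 t.2 v3 v4)))
      (Put t.1.1 t.1.2 v1 v3 true) Skip.

Definition rule_cmd : ccmd :=
  CFor v1 (CFor v2 (CFor v3 (CFor v4 (CIf matching_exp
    (cseqs [seq rule_body t | t <- triples]) Skip)))).

Definition empty_cmd : ccmd :=
  CIf (ball [seq ERel e e v1 v1 | e <- colors]) (PutF fFail true) Skip.

Definition round_body cd : ccmd :=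
  CIf (ball [seq BOr (ERel e e v1 v1) (BOr (ESym cd.1 e v2 v1) (ESym e cd.2 v1 v3))
             | e <- colors])
       (Put cd.1 cd.2 v2 v3 true) Skip.

Definition pass_cmd : ccmd :=
  CFor v2 (CFor v3 (cseqs [seq round_body cd | cd <- cpairs])).

Definition round_cmd : ccmd := CSeq empty_cmd pass_cmd.

Definition elim_cmd : ccmd := CFor v1 round_cmd.

Definition check_cmd : ccmd :=
  CSeq (PutF fFail false) (CSeq init_cmd (CSeq rule_cmd (CSeq elim_cmd
    (CIf (@BFlag cvar crel cflag fFail) Skip (PutF fAcc true))))).

Definition color_cmd : ccmd := cfors [seq vg pq.1 pq.2 | pq <- cpairs] check_cmd.

Lemma color_cmd_closed : well_scoped color_cmd && (fvars color_cmd == [::]).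
Proof. by vm_compute. Qed.

Section Correctness.
Variables (n : nat) (A : nat -> nat -> bool).
Hypothesis A_sym : forall u v, A u v = A v u.
Notation eval := (@eval cvar crel cflag n A).

Definition induced_matching x1 y1 x2 y2 :=
  [&& A x1 y1, A x2 y2, ~~ A x1 x2, ~~ A x1 y2, ~~ A y1 x2 & ~~ A y1 y2].

Definition valid (col : nat -> color) :=
  (forall u v, u < n -> v < n -> A u v -> col u != col v) /\
  (forall x1 y1 x2 y2 r, x1 < n -> y1 < n -> x2 < n -> y2 < n ->
     induced_matching x1 y1 x2 y2 ->
     col x1 != r -> col y1 != r -> col x2 != r -> col y2 != r -> False).

Section Guess.
Variable g : color -> color -> nat.

Definition bad c u :=
  has (fun q => A u (g c q)) colors ||
  (c != None) && ~~ has (fun pq => A u (g pq.1 pq.2)) cpairs.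

Definition base c d u v :=
  bad c u || bad d v ||
  A u v && ((c == d) || (~~ A u (g d c) || ~~ A v (g c d))).

Lemma bad_some u : exists c, bad c u.
Proof.
case: (boolP (has (fun pq => A u (g pq.1 pq.2)) cpairs)) => [/hasP[[p q] _ /= Hg]|Hn].
  by exists p; apply/orP; left; apply/hasP; exists q; rewrite ?mem_colors.
by exists (Some true); rewrite /bad Hn orbT.
Qed.

(* Colours [(p, r)] need [u] adjacent to [g r p], which excludes colour [r] for
   [u].  Hence the colour of one end decides which colour the edge avoids. *)
Lemma base_edge p q r u v : A u v -> base p r u v || base q r v u.
Proof.
move=> Auv; apply/orP.
case: (boolP (A u (g r p))) => Hu; last first.
  by left; rewrite /base Auv Hu /= !orbT.
case: (boolP (A u (g q r))) => Hv; last first.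
  by right; rewrite /base [A v u]A_sym Auv Hv /= !orbT.
right; rewrite /base {2}/bad; apply/orP; left; apply/orP; right; apply/orP; left.
by apply/hasP; exists p; rewrite ?mem_colors.
Qed.

End Guess.

Lemma beval_base c d x y rho m :
  beval A (base_exp c d x y) rho m =
  base (fun p q => rho (vg p q)) c d (rho x) (rho y).
Proof. by rewrite /base_exp /bad_exp; cbn -[bany colors cpairs]; rewrite !beval_bany. Qed.

Lemma init_correct rho m c d u v : u < n -> v < n ->
  mrel (eval init_cmd rho m) (c, d) u v = base (fun p q => rho (vg p q)) c d u v.
Proof.
move=> lt_u lt_v; set g := fun p q => _.
pose P (m : store crel cflag) := mrel m (c, d) u v = base g c d u v.
have keep i j cd m' : P m' -> P (eval (CIf (base_exp cd.1 cd.2 v1 v2)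
    (Put cd.1 cd.2 v1 v2 true) (Put cd.1 cd.2 v1 v2 false))
    (upd (upd rho v1 i) v2 j) m').
  move=> Hm'; rewrite eval_if beval_base /P.
  have -> : (upd (upd rho v1 i) v2 j v1) = i by [].
  have -> : (upd (upd rho v1 i) v2 j v2) = j by [].
  set b := base _ _ _ _ _.
  have -> : (if b then put m' (cd.1, cd.2) i j true else put m' (cd.1, cd.2) i j false)
    = put m' (cd.1, cd.2) i j b by case: b.
  rewrite /=; case: ifP => // /and3P[/eqP[Ec Ed] /eqP Eu /eqP Ev].
  by rewrite /b -Ec -Ed -Eu -Ev.
apply: (@for_est _ _ _ _ _ P _ _ _ u lt_u) => [m1|i m1 lt_i Hm1]; last first.
  apply: for_inv Hm1 => j m2 _; apply: seqs_inv => cd m3 _; exact: keep.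
apply: (@for_est _ _ _ _ _ P _ _ _ v lt_v) => [m2|j m2 lt_j Hm2]; last first.
  by apply: seqs_inv Hm2 => cd m3 _; exact: keep.
apply: (@seqs_est _ _ _ _ _ _ P _ _ _ (c, d)) => [|m3|cd m3]; last exact: keep.
  exact: mem_cpairs.
rewrite eval_if beval_base /P.
rewrite -[upd _ v2 v v2]/v -[upd _ v2 v v1]/u -/g; set b := base _ _ _ _ _.
by case: b; rewrite /= !eqxx.
Qed.

Lemma rule_closed rho m x1 y1 x2 y2 p p2 r :
  x1 < n -> y1 < n -> x2 < n -> y2 < n -> induced_matching x1 y1 x2 y2 ->
  r != p -> r != p2 -> mrel m (p, r) x1 y1 -> mrel m (p2, r) x2 y2 ->
  mrel (eval rule_cmd rho m) (p, p2) x1 x2.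
Proof.
move=> lt1 lt2 lt3 lt4 /and5P[A1 A2 A3 A4 /andP[A5 A6]] rp rp2 F1 F2.
pose rho' := upd (upd (upd (upd rho v1 x1) v2 y1) v3 x2) v4 y2.
have: hits n A rule_cmd rho (rule_body (p, p2, r)) rho'.
  apply: (hits_for _ lt1) => //; apply: (hits_for _ lt2) => //.
  apply: (hits_for _ lt3) => //; apply: (hits_for _ lt4) => //.
  apply: hits_if => [m'|]; first by rewrite /= A1 A2 A3 A4 A5 A6.
  apply: (hits_seqs (t := (p, p2, r))) => [t||] //; first exact: mem_triples.
  exact: hits_refl.
case/(_ m)=> m' [lem' _] [le _]; apply: le; cbn -[upd].
by rewrite rp rp2 !lem' //= !eqxx.
Qed.

Definition blocked (m : store crel cflag) k c d u v :=
  all (fun e => mrel m (e, e) k k ||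
    ((mrel m (c, e) u k || mrel m (e, c) k u) ||
     (mrel m (e, d) k v || mrel m (d, e) v k))) colors.

Lemma blocked_le m m' k c d u v : store_le m m' ->
  blocked m k c d u v -> blocked m' k c d u v.
Proof.
move=> [le _]; apply: sub_all => e /or3P[/le->|/orP[]/le->|/orP[]/le->] //;
  by rewrite !orbT.
Qed.

Lemma eval_round_body rho k u v cd m :
  eval (round_body cd) (upd (upd (upd rho v1 k) v2 u) v3 v) m =
  if blocked m k cd.1 cd.2 u v then put m (cd.1, cd.2) u v true else m.
Proof. by rewrite eval_if beval_ball. Qed.

Lemma round_closed rho m k c d u v : u < n -> v < n -> blocked m k c d u v ->
  mrel (eval round_cmd (upd rho v1 k) m) (c, d) u v.
Proof.
move=> lt_u lt_v Hb.
have: hits n A round_cmd (upd rho v1 k) (round_body (c, d))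
        (upd (upd (upd rho v1 k) v2 u) v3 v).
  apply: hits_seq => //; apply: (hits_for _ lt_u) => //; apply: (hits_for _ lt_v) => //.
  by apply: (hits_seqs (t := (c, d))) => [t||] //; [exact: mem_cpairs | exact: hits_refl].
case/(_ m)=> m' lem' [le _]; apply: le.
by rewrite eval_round_body (blocked_le lem') //= !eqxx.
Qed.

Lemma round_fail rho m k : all (fun e => mrel m (e, e) k k) colors ->
  mflag (eval round_cmd (upd rho v1 k) m) fFail.
Proof.
move=> Hk; rewrite eval_seq; have sc : setting pass_cmd by [].
have [_ le] := @setting_le _ _ _ n A _ (upd rho v1 k)
  (eval empty_cmd (upd rho v1 k) m) sc.
by apply: le; rewrite eval_if beval_ball Hk.
Qed.

Lemma round_le rho m k : store_le m (eval round_cmd (upd rho v1 k) m).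
Proof. exact: setting_le. Qed.

(* Extending a partial colouring to the eliminated vertex [k]: the colours left
   for [k] by each coloured vertex pairwise intersect inside a set of at most
   two colours, so they have a common element. *)
Lemma round_extend rho m k (a : nat -> color) : k < n ->
  (exists c, mrel m (c, c) k k) ->
  ~~ mflag (eval round_cmd (upd rho v1 k) m) fFail ->
  (forall u v, k < u < n -> k < v < n ->
     ~~ mrel (eval round_cmd (upd rho v1 k) m) (a u, a v) u v) ->
  exists a', forall u v, k <= u < n -> k <= v < n -> ~~ mrel m (a' u, a' v) u v.
Proof.
move=> lt_k [c0 Hc0] nfail Ha.
pose ok e u := ~~ (mrel m (a u, e) u k || mrel m (e, a u) k u).
have [e [He Hok]] : exists e, ~~ mrel m (e, e) k k /\ forall u, k < u < n -> ok e u.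
  have pair u v : k < u < n -> k < v < n ->
      exists e, [/\ ~~ mrel m (e, e) k k, ok e u & ok e v].
    move=> Hu Hv; have := Ha u v Hu Hv.
    case/andP: Hu Hv => _ lt_u /andP[_ lt_v] Hn.
    have /allPn[e _] : ~~ blocked m k (a u) (a v) u v.
      by apply: contra Hn => Hb; apply: round_closed.
    by rewrite !negb_or => /and3P[H1 /andP[H2 H3] /andP[H4 H5]];
      exists e; rewrite /ok !negb_or H1 H2 H3 H4 H5.
  have [e1 He1] : exists e1, ~~ mrel m (e1, e1) k k.
    have /allPn[e _ He] : ~~ all (fun e => mrel m (e, e) k k) colors.
      by apply: contra nfail; apply: round_fail.
    by exists e.
  have n01 : c0 != e1 by apply: contraNneq He1 => <-.
  case: (boolP [forall u : 'I_n, (k < u) ==> ok e1 u]) => [/forallP H|].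
    exists e1; split=> // u /andP[ku lt_u].
    by have := H (Ordinal lt_u); rewrite /= ku.
  rewrite negb_forall => /existsP[u]; rewrite negb_imply => /andP[ku n1u].
  have Hu : k < u < n by rewrite ku ltn_ord.
  have [e2 [He2 ok2u _]] := pair u u Hu Hu.
  have n02 : c0 != e2 by apply: contraNneq He2 => <-.
  have n12 : e1 != e2 by apply: contraNneq n1u => ->.
  exists e2; split=> // v Hv; have [e [He oku okv]] := pair u v Hu Hv.
  have ne0 : e != c0 by apply: contraNneq He => ->.
  have := two_colors n12 n01 n02 ne0.
  case/orP=> /eqP E; last by rewrite -E.
  by rewrite E (negbTE n1u) in oku.
exists (upd a k e) => u v /andP[ku lt_u] /andP[kv lt_v]; rewrite /upd.
have [le _] := round_le rho m k.
case: (u =P k) => [->|/eqP nu]; case: (v =P k) => [->|/eqP nv] //.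
- have /Hok : k < v < n by rewrite lt_v ltn_neqAle eq_sym nv kv.
  by rewrite /ok negb_or => /andP[].
- have /Hok : k < u < n by rewrite lt_u ltn_neqAle eq_sym nu ku.
  by rewrite /ok negb_or => /andP[].
- have Hu : k < u < n by rewrite lt_u ltn_neqAle eq_sym nu ku.
  have Hv : k < v < n by rewrite lt_v ltn_neqAle eq_sym nv kv.
  by apply: contra (Ha u v Hu Hv); apply: le.
Qed.

Lemma elim_sound rho m : (forall u, exists c, u < n -> mrel m (c, c) u u) ->
  ~~ mflag (eval elim_cmd rho m) fFail ->
  exists a, forall u v, u < n -> v < n -> ~~ mrel m (a u, a v) u v.
Proof.
move=> Hdom; pose body m i := eval round_cmd (upd rho v1 i) m.
have -> : eval elim_cmd rho m = foldl body m (iota 0 n) by [].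
suff gen d i m' : i + d = n -> store_le m m' ->
    ~~ mflag (foldl body m' (iota i d)) fFail ->
    exists a, forall u v, i <= u < n -> i <= v < n -> ~~ mrel m' (a u, a v) u v.
  by move=> /(gen n 0 m (add0n n) (store_le_refl m))[a Ha]; exists a => u v; apply: Ha.
elim: d i m' => [|d IH] i m' Ei lem' /=.
  by move=> _; exists (fun=> None) => u v Hu; lia.
have lem1 : store_le m' (body m' i) by apply: round_le.
move=> nfail; have [|a Ha] := IH i.+1 (body m' i) _ (store_le_trans lem' lem1) nfail.
  by lia.
have lt_i : i < n by lia.
apply: (@round_extend rho m' i a) => //.
- by have [c Hc] := Hdom i; exists c; apply: (proj1 lem'); apply: Hc.
- apply: contra nfail.
  suff mono s m1 : store_le m1 (foldl body m1 s) by apply: (proj2 (mono _ _)).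
  elim: s m1 => //= j s IHs m1; apply: store_le_trans (IHs _); exact: round_le.
Qed.

Section Invariance.
Variable col : nat -> color.
Hypothesis col_valid : valid col.

Definition respects (m : store crel cflag) :=
  forall u v, u < n -> v < n -> ~~ mrel m (col u, col v) u v.

Lemma respects_put m c d u v : respects m -> ~ (c = col u /\ d = col v) ->
  respects (put m (c, d) u v true).
Proof.
move=> Hm ncd u' v' lt_u lt_v /=; case: ifP => [|_]; last exact: Hm.
by case/and3P=> /eqP[Ec Ed] /eqP Eu /eqP Ev; case: ncd; rewrite -Ec -Ed Eu Ev.
Qed.

Lemma rule_respects rho m : respects m -> respects (eval rule_cmd rho m).
Proof.
apply: for_inv => {m} x1 m lt1; apply: for_inv => {m} y1 m lt2.
apply: for_inv => {m} x2 m lt3; apply: for_inv => {m} y2 m lt4 Hm.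
set rho' := upd _ v4 y2; rewrite eval_if; case: ifP => // Hmatch.
have {}Hmatch : induced_matching x1 y1 x2 y2.
  by move: Hmatch => /= /and3P[/andP[A1 A2] /andP[A3 A4] /andP[A5 A6]];
    rewrite /induced_matching A1 A2 A3 A4 A5 A6.
move: m Hm; apply: seqs_inv => -[[p p2] r] m _ Hm.
change (respects (if [&& (r != p) && (r != p2), mrel m (p, r) x1 y1 &
  mrel m (p2, r) x2 y2] then put m (p, p2) x1 x2 true else m)).
case: ifP => // /and3P[/andP[rp rp2] F1 F2]; apply: respects_put => // -[Ep Ep2].
case: col_valid => proper; apply; [| | | |exact: Hmatch| | | |] => //.
- by rewrite -Ep eq_sym; apply: rp.
- by apply: contraTneq F1 => <-; rewrite Ep; apply: Hm.
- by rewrite -Ep2 eq_sym.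
- by apply: contraTneq F2 => <-; rewrite Ep2; apply: Hm.
Qed.

Lemma elim_respects rho m : respects m -> ~~ mflag m fFail ->
  ~~ mflag (eval elim_cmd rho m) fFail.
Proof.
move=> Hm nf.
suff [] : respects (eval elim_cmd rho m) /\ ~~ mflag (eval elim_cmd rho m) fFail by [].
apply: (@for_inv _ _ _ n A (fun m => respects m /\ ~~ mflag m fFail)) => //.
move=> {Hm nf m} k m lt_k [Hm nf]; rewrite eval_seq eval_if beval_ball.
case: ifP => [/allP/(_ (col k) (mem_colors _))|_].
  by rewrite -[beval _ _ _ _]/(mrel m (col k, col k) k k) (negbTE (Hm k k lt_k lt_k)).
split; last first.
  by rewrite keeps_flag.
apply: for_inv (Hm) => u m1 lt_u; apply: for_inv => {m1} v m1 lt_v.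
apply: seqs_inv => -[c d] {}m1 _ Hm1.
rewrite eval_round_body.
case: ifP => // /allP/(_ (col k) (mem_colors _)) Hk; apply: respects_put => // -[Ec Ed].
rewrite Ec Ed in Hk.
by move: Hk; rewrite !(negbTE (Hm1 _ _ _ _)).
Qed.

End Invariance.

Definition good_guess (col : nat -> color) (g : color -> color -> nat) p q :=
  (forall v, v < n -> A v (g p q) -> col v != p) /\
  (p != q -> forall v w, v < n -> w < n -> A v w -> col v = q -> col w = p ->
     A v (g p q)).

Lemma guess_exists col : 0 < n -> valid col ->
  exists2 g, (forall p q, g p q < n) & forall p q, good_guess col g p q.
Proof.
move=> n_gt0 [proper nomatch].
suff H : forall pq : color * color, exists x : nat, x < n /\
    good_guess col (fun _ _ => x) pq.1 pq.2.
  have [g Hg] := fin_all_exists H.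
  by exists (fun p q => g (p, q)) => p q; have [] := Hg (p, q).
move=> [p q] /=.
case: (pickP (fun u : 'I_n => col u == p)) => [u0 Hu0|Hp]; last first.
  exists 0; split=> //; split=> [v lt_v _|_ v w _ lt_w _ _ Ew].
    by have := Hp (Ordinal lt_v) => /= ->.
  by have := Hp (Ordinal lt_w); rewrite /= Ew eqxx.
pose nb (u : 'I_n) := [set v : 'I_n | A v u & col v == q].
case: (@arg_maxnP _ u0 (fun u : 'I_n => col u == p) (fun u => #|nb u|) Hu0).
move=> x /eqP Ex Hmax; exists x; split=> //; split=> [v lt_v Avx|npq v w lt_v lt_w Avw Ev Ew].
  by rewrite -Ex; apply: proper.
apply: contraT => nAvx.
have [r /andP[rp rq]] := third_color p q.
have /subsetPn[v'] : ~~ (nb x \subset nb (Ordinal lt_w)).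
  apply/negP=> sub.
  have : nb x \proper nb (Ordinal lt_w).
    rewrite properE sub; apply/subsetPn; exists (Ordinal lt_v).
      by rewrite inE /= Avw Ev eqxx.
    by rewrite inE /= (negbTE nAvx).
  move/proper_card; rewrite ltnNge; apply/negP/negPn; apply: Hmax.
  by rewrite /= Ew.
rewrite !inE => /andP[Av'x /eqP Ev']; rewrite /= Ev' eqxx andbT => nAv'w.
exfalso; apply: (nomatch v w v' x r) => //; rewrite ?Ev ?Ew ?Ev' ?Ex 1?eq_sym //.
apply/and5P; split=> //; last (apply/andP; split).
- by apply: contraL (eqxx q) => /(proper _ _ lt_v (ltn_ord v')); rewrite Ev Ev'.
- by rewrite A_sym.
- apply: contraL (eqxx p) => /(proper _ _ lt_w (ltn_ord x)).
  by rewrite Ew Ex.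
Qed.

Definition normal (col : nat -> color) :=
  forall u, u < n -> (forall v, v < n -> ~~ A u v) -> col u = None.

Lemma valid_normal col : valid col -> exists2 col', valid col' & normal col'.
Proof.
move=> [proper nomatch].
pose iso u := [forall v : 'I_n, ~~ A u v].
have noniso u v : v < n -> A u v -> iso u = false.
  move=> lt_v Auv; apply/negP=> /forallP/(_ (Ordinal lt_v)).
  by rewrite /= Auv.
exists (fun u => if iso u then None else col u) => [|u lt_u Hu]; last first.
  by have -> : iso u by apply/forallP=> v; apply: Hu.
split=> [u v lt_u lt_v Auv|x1 y1 x2 y2 r lt1 lt2 lt3 lt4 Hm].
  by rewrite (noniso u v) // (noniso v u) ?proper // A_sym.
have /and3P[A1 A2 _] := Hm.
rewrite (noniso x1 y1) // (noniso y1 x1) 1?A_sym // (noniso x2 y2) //.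
by rewrite (noniso y2 x2) 1?A_sym //; apply: nomatch.
Qed.

Lemma base_good col g u v : valid col -> normal col ->
  (forall p q, g p q < n) -> (forall p q, good_guess col g p q) ->
  u < n -> v < n -> ~~ base g (col u) (col v) u v.
Proof.
move=> [proper _] col_norm lt_g Hg lt_u lt_v.
have Hbad w : w < n -> ~~ bad g (col w) w.
  move=> lt_w; rewrite /bad negb_or; apply/andP; split.
    apply/hasPn=> q _; apply/negP=> Awg.
    by have [/(_ w lt_w Awg)] := Hg (col w) q; rewrite eqxx.
  rewrite negb_and !negbK.
  case: (boolP (has _ cpairs)) => [|Hn]; rewrite ?orbT // orbF; apply/eqP.
  apply: col_norm => // x lt_x; apply/negP=> Awx; case/negP: Hn; apply/hasP.
  have nc := proper w x lt_w lt_x Awx.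
  have [_ /(_ _ w x lt_w lt_x Awx)] := Hg (col x) (col w).
  rewrite eq_sym => /(_ nc erefl erefl) Awg.
  by exists (col x, col w); rewrite ?mem_cpairs.
rewrite /base; have /negbTE-> := Hbad u lt_u; have /negbTE-> := Hbad v lt_v.
case: (boolP (A u v)) => //= Auv; have nc := proper u v lt_u lt_v Auv.
rewrite !negb_or nc !negbK /=; apply/andP; split.
  have [_ H] := Hg (col v) (col u); apply: (H _ u v) => //; by rewrite eq_sym.
by have [_ H] := Hg (col u) (col v); apply: (H _ v u) => //; rewrite A_sym.
Qed.

Lemma check_complete col rho m : valid col -> normal col ->
  (forall p q, rho (vg p q) < n) ->
  (forall p q, good_guess col (fun p q => rho (vg p q)) p q) ->
  mflag (eval check_cmd rho m) fAcc.
Proof.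
move=> col_valid col_norm lt_g Hg; rewrite /check_cmd !eval_seq eval_if.
set m1 := eval (PutF _ _) _ _; set m2 := eval init_cmd _ _.
set m3 := eval rule_cmd _ _.
have H2 : respects col m2.
  by move=> u v lt_u lt_v; rewrite init_correct //; apply: base_good.
have H3 : respects col m3 by apply: rule_respects.
have nf3 : ~~ mflag m3 fFail by rewrite /m3 keeps_flag // /m2 keeps_flag.
by rewrite [beval _ _ _ _](negbTE (elim_respects rho H3 nf3)).
Qed.

Lemma check_sound rho m : ~~ mflag m fAcc -> mflag (eval check_cmd rho m) fAcc ->
  exists col, valid col.
Proof.
move=> nacc; rewrite /check_cmd !eval_seq eval_if.
set m1 := eval (PutF _ _) _ _; set m2 := eval init_cmd _ _.
set m3 := eval rule_cmd _ _; set m4 := eval elim_cmd _ _.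
have nacc4 : ~~ mflag m4 fAcc.
  by rewrite /m4 keeps_flag // /m3 keeps_flag // /m2 keeps_flag.
set g := fun p q => rho (vg p q).
have E2 c d u v : u < n -> v < n -> mrel m2 (c, d) u v = base g c d u v.
  by move=> lt_u lt_v; rewrite init_correct.
have [le3 _] : store_le m2 m3 by apply: setting_le.
case: (boolP (beval A (BFlag _ _ fFail) rho m4)) => [_|nfail _].
  by rewrite /= (negbTE nacc4).
have [u|col Hcol] := elim_sound _ nfail.
  have [c Hc] := bad_some g u; exists c => lt_u; apply: le3.
  by rewrite E2 // /base Hc.
have Hbase u v : u < n -> v < n -> ~~ base g (col u) (col v) u v.
  move=> lt_u lt_v; rewrite -E2 //.
  by apply: contra (Hcol u v lt_u lt_v); apply: le3.
have proper u v : u < n -> v < n -> A u v -> col u != col v.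
  move=> lt_u lt_v Auv; apply: contraNneq (Hbase u v lt_u lt_v) => E.
  by rewrite /base Auv E eqxx /= orbT.
exists col; split=> // x1 y1 x2 y2 r lt1 lt2 lt3 lt4 Hm n1 n2 n3 n4.
wlog H1 : x1 y1 lt1 lt2 Hm n1 n2 / mrel m2 (col x1, r) x1 y1.
  move=> W; have A1 : A x1 y1 by case/andP: Hm.
  have /orP[] : base g (col x1) r x1 y1 || base g (col y1) r y1 x1.
  - exact: base_edge.
  - by rewrite -E2 // => /W; apply.
  - rewrite -E2 // => /W; apply=> //; move: Hm => /and5P[? ? ? ? /andP[? ?]].
    by rewrite /induced_matching [A y1 x1]A_sym; apply/and5P; split=> //; apply/andP.
wlog H2 : x2 y2 lt3 lt4 Hm n3 n4 / mrel m2 (col x2, r) x2 y2.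
  move=> W; have A2 : A x2 y2 by case/and3P: Hm.
  have /orP[] : base g (col x2) r x2 y2 || base g (col y2) r y2 x2.
  - exact: base_edge.
  - by rewrite -E2 // => /W; apply.
  - rewrite -E2 // => /W; apply=> //; move: Hm => /and5P[? ? ? ? /andP[? ?]].
    by rewrite /induced_matching [A y2 x2]A_sym; apply/and5P; split=> //; apply/andP.
have := Hcol x1 x2 lt1 lt3; rewrite (@rule_closed rho m2 x1 y1 x2 y2 _ _ r) //.
- by rewrite eq_sym.
- by rewrite eq_sym.
Qed.

Theorem color_cmd_correct rho m : 0 < n -> ~~ mflag m fAcc ->
  mflag (eval color_cmd rho m) fAcc <-> exists col, valid col.
Proof.
move=> n_gt0 nacc; split=> [|[col0 /valid_normal[col col_valid col_norm]]].
  by case/(cfors_flag_reached nacc)=> rho' [m' [nacc']]; apply: check_sound.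
have [g lt_g Hg] := guess_exists n_gt0 col_valid.
pose rhos (x : cvar) := if x is inl pq then g pq.1 pq.2 else 0.
apply: (@cfors_reach_flag _ _ _ _ _ _ _ _ rho rhos [::]) => //.
- move=> rho' m' Hm'; rewrite /check_cmd !eval_seq eval_if.
  set m4 := eval elim_cmd _ _; have Hm4 : mflag m4 fAcc.
    by rewrite /m4 !keeps_flag.
  by case: ifP.
- by move=> x /mapP[[p q] _ ->] /=.
- move=> rho' m' Hrho'; have E p q : rho' (vg p q) = g p q.
    by apply: Hrho'; apply/mapP; exists (p, q); rewrite ?mem_cpairs.
  apply: check_complete col_valid col_norm _ _ => p q; first by rewrite E.
  by have [H1 H2] := Hg p q; split; rewrite E.
Qed.

End Correctness.

(** * Graphs and colourings *)

Section Graph.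
Variables (n : nat) (G : sgraph n).

Definition gadj (u v : nat) : bool :=
  if (insub u, insub v) is (Some i, Some j) then adj G i j else false.

Lemma gadjE (i j : 'I_n) : gadj i j = adj G i j.
Proof. by rewrite /gadj !valK. Qed.

Lemma gadj_sym u v : gadj u v = gadj v u.
Proof. by rewrite /gadj; case: insub => [i|]; case: insub => [j|] //; apply: adj_sym. Qed.

Lemma encodeE : encode G = mkseq (fun j => gadj (j %/ n) (j %% n)) (n * n).
Proof.
have -> : encode G = [seq gadj u v | u <- iota 0 n, v <- iota 0 n].
  rewrite /encode -val_enum_ord allpairs_mapl allpairs_mapr.
  by apply: eq_allpairs => i j; rewrite gadjE.
suff gen k : [seq gadj u v | u <- iota 0 k, v <- iota 0 n] =
    mkseq (fun j => gadj (j %/ n) (j %% n)) (k * n) by apply: gen.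
elim: k => // k IH.
rewrite -[k.+1]addn1 iotaD allpairs_cat IH /= cats0 add0n mulnDl mul1n.
rewrite /mkseq iotaD map_cat.
congr (_ ++ _); rewrite add0n -[k * n]addn0 iotaDl -map_comp.
apply/eq_in_map => j; rewrite mem_iota /= => lt_j.
have n_gt0 : 0 < n by lia.
by rewrite divnMDl // modnMDl divn_small // modn_small // addn0.
Qed.

Definition ord_color (i : 'I_3) : color :=
  match val i with 0 => None | 1 => Some false | _ => Some true end.
Definition color_ord (c : color) : 'I_3 :=
  match c with None => @Ordinal 3 0 isT | Some false => @Ordinal 3 1 isT
             | Some true => @Ordinal 3 2 isT end.

Lemma color_ordK : cancel color_ord ord_color. Proof. by case=> [[]|]. Qed.
Lemma ord_colorK : cancel ord_color color_ord.
Proof. by case=> [[|[|[|//]]] lt_i]; apply: val_inj. Qed.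

Lemma valid_colorable : (exists col, valid n gadj col) <-> avoid2K2_colorable G 3.
Proof.
split=> [[col [proper nomatch]]|/existsP[c /andP[/forallP proper /forallP nomatch]]].
  apply/existsP; exists [ffun i : 'I_n => color_ord (col i)]; apply/andP; split.
    apply/forallP=> x; apply/forallP=> y; apply/implyP=> Axy.
    by rewrite !ffunE (can_eq color_ordK) proper ?gadjE.
  apply/forallP=> a; apply/forallP=> b; apply/implyP=> nab; apply/negP.
  case/existsP=> x1 /existsP[y1 /existsP[x2 /existsP[y2]]].
  have [r /andP[ra rb]] := third_color (ord_color a) (ord_color b).
  have neq (x : 'I_n) : x \in [set v | ([ffun i : 'I_n => color_ord (col i)] v == a) ||
                  ([ffun i : 'I_n => color_ord (col i)] v == b)] -> col x != r.
    rewrite !inE !ffunE => H; apply: contraTneq H => ->.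
    by rewrite !(can2_eq color_ordK ord_colorK) negb_or ra rb.
  case/and3P=> /and4P[/neq n1 /neq n2 /neq n3 /neq n4] _.
  case/and5P=> A1 A2 A3 A4 /andP[A5 A6].
  apply: (nomatch x1 y1 x2 y2 r) => //.
  by rewrite /induced_matching !gadjE A1 A2 A3 A4 A5 A6.
pose col (u : nat) : color := if insub u is Some i then ord_color (c i) else None.
have colE (i : 'I_n) : col i = ord_color (c i) by rewrite /col valK.
exists col; split.
  move=> u v lt_u lt_v; rewrite -[u]/(val (Ordinal lt_u)) -[v]/(val (Ordinal lt_v)).
  rewrite gadjE !colE (can_eq ord_colorK).
  by have /forallP/(_ (Ordinal lt_v))/implyP := proper (Ordinal lt_u).
move=> u1 w1 u2 w2 r lt1 lt2 lt3 lt4.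
rewrite -[u1]/(val (Ordinal lt1)) -[w1]/(val (Ordinal lt2)).
rewrite -[u2]/(val (Ordinal lt3)) -[w2]/(val (Ordinal lt4)).
move: (Ordinal lt1) (Ordinal lt2) (Ordinal lt3) (Ordinal lt4) => x1 y1 x2 y2.
rewrite /induced_matching !gadjE !colE => /and5P[A1 A2 A3 A4 /andP[A5 A6]] n1 n2 n3 n4.
have [p pr] : exists p : color, p != r by case: (r) => [b|]; [exists None|exists (Some true)].
have [q /andP[qp qr]] := third_color p r.
have pq : p != q by rewrite eq_sym.
have cover (x : 'I_n) : ord_color (c x) != r ->
    x \in [set v | (c v == color_ord p) || (c v == color_ord q)].
  rewrite inE -!(can2_eq ord_colorK color_ordK) => nr.
  by apply: two_colors nr; rewrite // 1?eq_sym // eq_sym.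
have /forallP/(_ (color_ord q))/implyP := nomatch (color_ord p).
rewrite (can_eq color_ordK) => /(_ pq) /negP; apply.
apply/existsP; exists x1; apply/existsP; exists y1.
apply/existsP; exists x2; apply/existsP; exists y2.
rewrite !cover // A1 A2 A3 A4 A5 A6 /= !inE !negb_or !andbT.
have adj_neq (x y : 'I_n) : adj G x y -> x != y.
  by apply: contraTneq => ->; rewrite adj_irr.
have neq_l (x y z : 'I_n) : adj G x z -> ~~ adj G y z -> x != y.
  by move=> Axz; apply: contraNneq => <-.
have A1' : adj G y1 x1 by rewrite adj_sym.
rewrite (adj_neq _ _ A1) (adj_neq _ _ A2) (neq_l x1 x2 y1) ?(neq_l x1 y2 y1) //.
- by rewrite (neq_l y1 x2 x1) ?(neq_l y1 y2 x1) // adj_sym.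
- by rewrite adj_sym.
- by rewrite adj_sym.
Qed.

Lemma avoid2K2_colorableW k k' : k <= k' ->
  avoid2K2_colorable G k -> avoid2K2_colorable G k'.
Proof.
move=> le_k /existsP[c /andP[/forallP proper /forallP nomatch]]; apply/existsP.
exists [ffun v => widen_ord le_k (c v)]; apply/andP; split.
  apply/forallP=> x; apply/forallP=> y; apply/implyP=> Axy; rewrite !ffunE.
  by have /forallP/(_ y)/implyP/(_ Axy) := proper x.
apply/forallP=> a; apply/forallP=> b; apply/implyP=> nab; apply/negP.
case/existsP=> x1 /existsP[y1 /existsP[x2 /existsP[y2]]].
case/and3P=> /and4P[]; rewrite !inE !ffunE => H1 H2 H3 H4 Hu Hadj.
have A1 : adj G x1 y1 by case/andP: Hadj.
have nxy : c x1 != c y1 by have /forallP/(_ y1)/implyP/(_ A1) := proper x1.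
have inj : injective (widen_ord le_k) by move=> i j [] /val_inj.
have in_xy z : (widen_ord le_k (c z) == a) || (widen_ord le_k (c z) == b) ->
    (c z == c x1) || (c z == c y1).
  rewrite -!(inj_eq inj); move: nxy; rewrite -(inj_eq inj).
  by case/orP: H1 => /eqP->; case/orP: H2 => /eqP->; rewrite ?eqxx // orbC.
have /forallP/(_ (c y1))/implyP/(_ nxy)/negP := nomatch (c x1); apply.
apply/existsP; exists x1; apply/existsP; exists y1.
apply/existsP; exists x2; apply/existsP; exists y2.
by rewrite Hu Hadj !inE !in_xy.
Qed.

Lemma chi_2K2_leq k : (chi_2K2 G <= k) = avoid2K2_colorable G k.
Proof.
rewrite /chi_2K2; case: ex_minnP => m Hm minm; apply/idP/idP => [le_m|]; last exact: minm.
exact: avoid2K2_colorableW Hm.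
Qed.

End Graph.

(** * Running time *)

Definition poly_bounded (f : nat -> nat) := exists a d, forall L, f L <= a * L.+1 ^ d.

Lemma poly_bounded_const c : poly_bounded (fun=> c).
Proof. by exists c, 0 => L; rewrite muln1. Qed.

Lemma poly_bounded_id : poly_bounded id.
Proof. by exists 1, 1 => L; rewrite mul1n expn1. Qed.

Lemma poly_bounded_add f g : poly_bounded f -> poly_bounded g ->
  poly_bounded (fun L => f L + g L).
Proof.
move=> [a [d Hf]] [b [e Hg]]; exists (a + b), (d + e) => L; rewrite mulnDl.
apply: leq_add; [apply: leq_trans (Hf L) _ | apply: leq_trans (Hg L) _];
  by rewrite leq_mul // leq_pexp2l // ?leq_addr ?leq_addl.
Qed.

Lemma poly_bounded_mul f g : poly_bounded f -> poly_bounded g ->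
  poly_bounded (fun L => f L * g L).
Proof.
move=> [a [d Hf]] [b [e Hg]]; exists (a * b), (d + e) => L.
by rewrite expnD mulnACA leq_mul.
Qed.

Lemma poly_bounded_affine f : poly_bounded f ->
  exists c d, forall L, f L <= c * L ^ d + c.
Proof.
move=> [a [d Hf]]; exists (a * 2 ^ d), d => L; apply: leq_trans (Hf L) _.
case: L {Hf} => [|L]; first by rewrite exp1n; have := expn_gt0 2 d; nia.
apply: leq_trans (leq_addr _ _); rewrite -mulnA -expnMn leq_mul2l.
by apply/orP; right; case: (d) => // d'; rewrite leq_exp2r //; lia.
Qed.

Lemma exec_nil (cell : finType) (p : prog cell) : exists k, exec p k [::] false [::].
Proof.
elim: p => [f|p1 [k1 H1] p2 [k2 H2]|f p1 _ p2 [k2 H2]|f p _].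
- by exists 1; apply: exec_sweep.
- by exists (k1 + k2); apply: exec_seq H1 H2.
- by exists k2.+1; apply: exec_if (erefl : sweep _ _ f [::] = (false, [::])) H2.
- by exists 1; apply: exec_while_exit.
Qed.

(** * The machine *)

Definition ctrack : finType := track cvar crel cflag.
Definition ccell : finType := cell cvar crel cflag.
Definition ccell_enc (c : ccell) : seq bool := [seq c t | t <- enum ctrack].
Definition ccell_dec (s : seq bool) : ccell := [ffun t => nth false s (index t (enum ctrack))].

Lemma size_ccell_enc c : size (ccell_enc c) = #|ctrack|.
Proof. by rewrite size_map cardE. Qed.

Lemma ccell_encK : cancel ccell_enc ccell_dec.
Proof.
move=> c; apply/ffunP=> t; rewrite ffunE.
have t_in : t \in enum ctrack by rewrite mem_enum.
by rewrite (nth_map t) ?index_mem // nth_index.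
Qed.

Lemma ctrack_gt0 : 0 < #|ctrack|.
Proof. by apply/card_gt0P; exists (tStart _ _ _). Qed.

(* The last sweep looks for a cell without the accepting mark, so that the
   empty graph, whose tape has no cell, is accepted. *)
Definition main_prog : prog ccell :=
  PSeq (setup_prog _ _ _) (PSeq (compile color_cmd)
    (PSweep (read_act (fun c : ccell => ~~ c (tFlag _ _ fAcc))))).

Definition main_TM : TM :=
  sim_TM sreg0 sres (@pc_act _ main_prog) (@pc_next _ main_prog) (pc_entry main_prog)
    (@input_cell _ _ _) #|ctrack| ccell_enc ccell_dec.

Definition store0 : store crel cflag := Store (fun _ _ _ => false) (fun=> false).

Lemma main_prog_correct n (G : sgraph n) : 0 < n ->
  exists s, exec main_prog (n * n * 12 + 13 + (cost n color_cmd + 1))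
    (map (@input_cell _ _ _) (encode G)) (~~ (chi_2K2 G <= 3)) s.
Proof.
move=> n_gt0; have /andP[scoped /eqP closed] := color_cmd_closed.
have [b1 H1] := @setup_prog_correct cvar crel cflag n (gadj G) store0 n_gt0
  (fun _ _ _ => erefl) (fun=> erefl).
have [||b2 H2] := @compile_correct cvar crel cflag n (gadj G) n_gt0 color_cmd (fun=> n)
  store0 scoped.
- by [].
- by move=> x; rewrite closed.
set m := eval _ _ _ _ _ in H2.
eexists; rewrite encodeE; apply: exec_seq H1 (exec_seq H2 (exec_sweep _)).
rewrite sweep_read; congr pair; rewrite chi_2K2_leq.
have Hm : avoid2K2_colorable G 3 <-> mflag m fAcc.
  apply: iff_trans (iff_sym (valid_colorable G)) (iff_sym _).
  exact: color_cmd_correct (gadj_sym G) _ _ n_gt0 _.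
have -> : avoid2K2_colorable G 3 = mflag m fAcc by apply/idP/idP => /Hm.
apply/hasP/idP => [[j _]|Hacc]; first by rewrite ffunE.
by exists 0; rewrite ?ffunE // mem_iota muln_gt0 n_gt0.
Qed.

(** The problem "chi_{2K_2}(G) <= 3 ?" is decided by a deterministic Turing
    machine in time polynomial in the input length. *)
Theorem theorem2 :
  exists (M : TM) (c d : nat),
    forall (n : nat) (G : sgraph n),
      exists t : nat,
        t <= c * (size (encode G)) ^ d + c /\
        halted (run M (encode G) t) /\
        ((cstate (run M (encode G) t) == tm_accept M) = (chi_2K2 G <= 3)).
Proof.
have [k0 Hk0] := exec_nil main_prog.
have [a [e Hcost]] := cost_poly color_cmd.
pose k L := k0 + (L * 12 + 13 + (a * L.+1 ^ e + 1)).
have [c [d Hcd]] : exists c d, forall L, sim_time #|ctrack| (k L) L <= c * L ^ d + c.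
  apply: poly_bounded_affine.
  have poly_k : poly_bounded k.
    do ![apply: poly_bounded_add | apply: poly_bounded_mul | apply: poly_bounded_const
        | apply: poly_bounded_id].
    by exists 1, e => L; rewrite mul1n.
  by do ![exact: poly_k | apply: poly_bounded_add | apply: poly_bounded_mul
        | apply: poly_bounded_const | apply: poly_bounded_id].
exists main_TM, c, d => n G; set w := encode G.
have [s Hs] : exists s, exec main_prog (k (size w)) (map (@input_cell _ _ _) w)
    (~~ (chi_2K2 G <= 3)) s.
  have [n0|n_gt0] := posnP n.
    exists [::]; have -> : w = [::] by apply/nilP; rewrite /nilp /w encodeE size_mkseq n0.
    have -> : chi_2K2 G <= 3.
      rewrite chi_2K2_leq; apply/(valid_colorable G); exists (fun=> None).
      by split=> [u v|x1 y1 x2 y2 r]; rewrite [X in _ < X]n0.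
    by apply: exec_leq Hk0; apply: leq_addr.
  have [s Hs] := main_prog_correct G n_gt0; exists s; apply: exec_leq Hs.
  have -> : size w = n * n by rewrite /w encodeE size_mkseq.
  rewrite /k; apply: leq_trans (leq_addl _ _); rewrite leq_add2l leq_add2r.
  apply: leq_trans (Hcost n) _; rewrite leq_mul2l; apply/orP; right.
  by case: (e) => // e'; rewrite leq_exp2r //; nia.
have [t [le_t [halt_t acc_t]]] := sim_TM_correct ctrack_gt0 size_ccell_enc ccell_encK Hs.
exists t; split; first exact: leq_trans le_t (Hcd _).
by split=> //; rewrite acc_t negbK.
Qed.
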